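(* Let $N\ge 2$, $0<s,t<1$, $2<p<+\infty$, $a,b>0$ constants, and $f,g\in C^{1}\left((0,+\infty)\times(0,+\infty),\mathbb{R}\right)$. Let $u\in C^{1,1}_{loc}(\mathbb{R}^{N})\cap \mathcal{L}_{sp}\cap C(\mathbb{R}^{N})$ and $v\in C^{1,1}_{loc}(\mathbb{R}^{N})\cap \mathcal{L}_{tp}\cap C(\mathbb{R}^{N})$ be a positive solution pair (i.e. $u>0$, $v>0$ in $\mathbb{R}^N$) of $$\begin{cases}(-\Delta)_{p}^{s}u+au^{p-1}=f(u,v) & \text{in } \mathbb{R}^{N},\\ (-\Delta)_{p}^{t}v+bv^{p-1}=g(u,v) & \text{in } \mathbb{R}^{N}.\end{cases}$$ Suppose that (i) $\frac{\partial f}{\partial v}>0$ and $\frac{\partial g}{\partial u}>0$ for all $u,v>0$; (ii) $\frac{\partial f}{\partial u}\leq u^{m-1}v^{n}$ and $\frac{\partial f}{\partial v}\leq u^{m}v^{n-1}$ as $(u,v)\rightarrow(0^{+},0^{+})$; (iii) $\frac{\partial g}{\partial u}\leq u^{q-1}v^{r}$ and $\frac{\partial g}{\partial v}\leq u^{q}v^{r-1}$ as $(u,v)\rightarrow(0^{+},0^{+})$; (iv) $\frac{\partial f}{\partial u}-a(p-1)u^{p-2}$ is increasing with respect to $u$ as $u\rightarrow 0^{+}$, and $\frac{\partial g}{\partial v}-b(p-1)v^{p-2}$ is increasing with respect to $v$ as $v\rightarrow 0^{+}$; (v) $u(x)\sim \frac{1}{|x|^{\gamma}}$ and $v(x)\sim\frac{1}{|x|^{\tau}}$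 as $|x|\rightarrow\infty$, where $m,r\geq p-1$, $n,q\geq 1$ and $\gamma,\tau>0$ satisfy $$\min\{\gamma(m-1)+\tau n,\ \gamma m+\tau(n-1)\}>\gamma(p-2)+sp$$ and $$\min\{\tau(r-1)+\gamma q,\ \tau r+\gamma(q-1)\}>\tau(p-2)+tp.$$ Then $u$ and $v$ are radially symmetric and monotone decreasing about some point in $\mathbb{R}^{N}$.
   Context: For $0<s<1$ and $2<p<\infty$, the fractional $p$-Laplacian is $$(-\Delta)_p^s u(x) := C_{N,sp}\, PV \int_{\mathbb{R}^N} \frac{|u(x)-u(y)|^{p-2}[u(x)-u(y)]}{|x-y|^{N+sp}}\, dy,$$ where $PV$ denotes the Cauchy principal value and $C_{N,sp}>0$ is a normalization constant; $(-\Delta)_p^t$ is defined in the same way with $t$ in place of $s$ (constant $C_{N,tp}>0$). Equations are understood pointwise. The function spaces are $$\mathcal{L}_{sp} := \Big\{ u \in L^{p-1}_{loc} \ \Big|\ \int_{\mathbb{R}^N} \frac{|1+u(x)|^{p-1}}{1+|x|^{N+sp}}\, dx < \infty \Big\},\qquad \mathcal{L}_{tp} := \Big\{ v \in L^{p-1}_{loc} \ \Big|\ \int_{\mathbb{R}^N} \frac{|1+v(x)|^{p-1}}{1+|x|^{N+tp}}\, dx < \infty \Big\}.$$ Partial derivatives of $f$ and $g$ are with respect to their first argument $u$ and second argument $v$, evaluated at $(u,v)$. An inequality ''as $(u,v)\to(0^+,0^+)$'' means that it holds for all sufficiently small $u,v>0$. In (iv), ''increasing with respect to $u$ as $u\to0^+$''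 means increasing in $u$ on some interval $(0,\varepsilon)$, for every $v>0$ (with $\varepsilon>0$ independent of $v$), and similarly with the roles of $u,v$ exchanged for the second function. The notation $w(x)\sim |x|^{-\kappa}$ as $|x|\to\infty$ means that there are constants $0<c\le C$ such that $c|x|^{-\kappa}\le w(x)\le C|x|^{-\kappa}$ for all sufficiently large $|x|$. *)

(* Defs.v *)
From HB Require Import structures.
From mathcomp Require Import all_boot all_order all_algebra.
From mathcomp Require Import all_classical all_reals all_analysis.

Set Implicit Arguments.
Unset Strict Implicit.
Unset Printing Implicit Defensive.

Import Order.TTheory GRing.Theory Num.Theory.
Import numFieldNormedType.Exports.

Local Open Scope classical_set_scope.
Local Open Scope ring_scope.

(* The sigma-algebra on R^n generated by the coordinates, i.e. the Borel one. *)
Section measurable_rV.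
Context {d} {T : sigmaRingType d} (n : nat).

Let coors : 'I_n -> 'rV[T]_n -> T := fun i x => x ord0 i.

Let rV_set0 : g_sigma_preimage coors set0.
Proof. exact: sigma_algebra0. Qed.

Let rV_setC A : g_sigma_preimage coors A -> g_sigma_preimage coors (~` A).
Proof. exact: sigma_algebraC. Qed.

Let rV_bigcup (F : _^nat) : (forall i, g_sigma_preimage coors (F i)) ->
  g_sigma_preimage coors (\bigcup_i (F i)).
Proof. exact: sigma_algebra_bigcup. Qed.

HB.instance Definition _ := @isMeasurable.Build (measure_tuple_display d)
  'rV[T]_n (g_sigma_preimage coors) rV_set0 rV_setC rV_bigcup.

End measurable_rV.

Lemma measurable_coord d (T : sigmaRingType d) n (i : 'I_n) :
  measurable_fun [set: 'rV[T]_n] (fun x => x ord0 i).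
Proof.
move=> _ Y mY; rewrite setTI; apply: sub_sigma_algebra => /=.
rewrite -bigcup_seq/=; exists i => /=; first by rewrite mem_index_enum.
by exists Y => //; rewrite setTI.
Qed.

Lemma measurable_fun_rVP d1 d2 (T1 : measurableType d1)
    (T2 : measurableType d2) n (f : T1 -> 'rV[T2]_n) :
  measurable_fun [set: T1] f <->
  forall i, measurable_fun [set: T1] (fun x => f x ord0 i).
Proof.
split=> [mf i|mf].
  exact: (measurableT_comp (measurable_coord i) mf).
move=> _ A mA; rewrite setTI.
pose S := [set A : set 'rV[T2]_n | measurable (f @^-1` A)].
suff mS : measurable `<=` S by exact: mS.
apply: smallest_sub.
  split=> [|B /= mB|F /= mF]; rewrite /S /=.
  - by rewrite preimage_set0.
  - by rewrite setTD preimage_setC; exact: measurableC.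
  - by rewrite preimage_bigcup; apply: bigcupT_measurable.
rewrite -bigcup_seq; apply: bigcup_sub => i _ B [C mC <-].
by rewrite /S /= setTI -[_ @^-1` _]setTI; exact: mf.
Qed.

Section lebesgue_rV.
Context {R : realType}.

Definition rV_cons n (z : measurableTypeR R * 'rV[R]_n) : 'rV[R]_n.+1 :=
  row_mx (const_mx z.1 : 'rV_1) z.2.

Let rV_cons0 n z (j : 'I_1) : @rV_cons n z ord0 (lshift n j) = z.1.
Proof. by apply: etrans (row_mxEl _ _ _ _) _; rewrite mxE. Qed.

Let rV_consS n z (j : 'I_n) : @rV_cons n z ord0 (rshift 1 j) = z.2 ord0 j.
Proof. exact: row_mxEr. Qed.

Let measurable_rV_cons n :
  measurable_fun [set: measurableTypeR R * 'rV[R]_n] (@rV_cons n).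
Proof.
apply/measurable_fun_rVP => i.
case: (split_ordP (i : 'I_(1 + n))) => j ->.
  by rewrite (_ : (fun _ => _) = fst)//; apply/funext => z; rewrite rV_cons0.
rewrite (_ : (fun _ => _) = (fun y : 'rV_n => y ord0 j) \o snd); last first.
  by apply/funext => z; rewrite rV_consS.
exact: (measurableT_comp (measurable_coord j)).
Qed.

Section step.
Variables (n : nat) (mu : {sigma_finite_measure set 'rV[R]_n -> \bar R}).

Let m : set 'rV[R]_n.+1 -> \bar R :=
  pushforward (@lebesgue_measure R \x mu)%E (@rV_cons n).

Let M : {measure set 'rV[R]_n.+1 -> \bar R} :=
  measure_function_pushforward__canonical__measure_function_Measure
    (@lebesgue_measure R \x mu)%E (@measurable_rV_cons n).

HB.instance Definition _ := isMeasure.Build _ _ _ m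
  (measure0 M) (measure_ge0 M) (@measure_semi_sigma_additive _ _ _ M).

Let m_sigma_finite : sigma_finite setT m.
Proof.
have /sigma_finiteP[F [TF ndF Foo]] := sigma_finiteT (@lebesgue_measure R).
have /sigma_finiteP[G [TG ndG Goo]] := sigma_finiteT mu.
pose unc (x : 'rV[R]_n.+1) : measurableTypeR R * 'rV[R]_n :=
  (x ord0 ord0, rsubmx (x : 'rV_(1 + n))).
have consK z : unc (rV_cons z) = z.
  case: z => a y; congr pair; last exact: row_mxKr.
  by rewrite (_ : ord0 = lshift n (ord0 : 'I_1)) ?rV_cons0//; exact: val_inj.
have munc : measurable_fun setT unc.
  apply/measurable_fun_pairP; split; first exact: measurable_coord.
  apply/measurable_fun_rVP => i /=.
  rewrite (_ : (fun _ => _) =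
    (fun x : 'rV[R]_n.+1 => x ord0 (rshift 1 i : 'I_n.+1))).
    exact: measurable_coord.
  by apply/funext => x; rewrite mxE.
exists (fun k => unc @^-1` (F k `*` G k)).
  apply/seteqP; split=> // x _.
  have [i _ Fi] : (\bigcup_k F k) (unc x).1 by rewrite -TF.
  have [j _ Gj] : (\bigcup_k G k) (unc x).2 by rewrite -TG.
  exists (maxn i j) => //; split.
    by move: (unc x).1 Fi; exact/subsetPset/ndF/leq_maxl.
  by move: (unc x).2 Gj; exact/subsetPset/ndG/leq_maxr.
move=> k; have [mF Fk] := Foo k; have [mG Gk] := Goo k; split.
  by rewrite -[X in measurable X]setTI; apply: munc => //; exact: measurableX.
rewrite /m /pushforward -comp_preimage (_ : unc \o _ = id); last first.
  by apply/funext => z /=.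
by rewrite preimage_id product_measure1E// lte_mul_pinfty// ge0_fin_numE.
Qed.

HB.instance Definition _ := @Measure_isSigmaFinite.Build _ _ _ m m_sigma_finite.

Definition lebesgue_rV_step : {sigma_finite_measure set 'rV[R]_n.+1 -> \bar R} := m.

End step.

Fixpoint lebesgue_rV n : {sigma_finite_measure set 'rV[R]_n -> \bar R} :=
  match n with
  | 0 => \d_(0 : 'rV[R]_0)
  | n'.+1 => lebesgue_rV_step (lebesgue_rV n')
  end.

Lemma lebesgue_rV_box n (A : 'I_n -> set R) :
  (forall i, measurable (A i)) ->
  lebesgue_rV n [set x | forall i, A i (x ord0 i)] =
  (\prod_(i < n) @lebesgue_measure R (A i))%E.
Proof.
elim: n A => [|n IH] A mA.
  by rewrite big_ord0 /= diracE mem_set// => -[].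
have mB : measurable [set x : 'rV[R]_n | forall i, A (lift ord0 i) (x ord0 i)].
  rewrite (_ : [set _ | _] = \bigcap_(i in [set: 'I_n])
      ((fun x : 'rV[R]_n => x ord0 i) @^-1` A (lift ord0 i))); last first.
    by apply/seteqP; split=> x /= h i; [move=> _|]; exact: h.
  apply: fin_bigcap_measurable => // i _.
  by rewrite -[X in measurable X]setTI; exact: measurable_coord.
rewrite big_ord_recl -IH// -product_measure1E//=; last exact: mA.
rewrite /pushforward; congr (_ _); apply/seteqP; split=> z /=.
  move=> h; split=> [|i].
    rewrite -(@rV_cons0 n z ord0) (_ : lshift n ord0 = ord0); first exact: h.
    exact: val_inj.
  by rewrite -rV_consS -rshift1; exact: h.
case=> h0 hS i; case: (split_ordP (i : 'I_(1 + n))) => j ->.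
  by rewrite rV_cons0 ord1 (_ : lshift n ord0 = ord0)//; exact: val_inj.
by rewrite rV_consS rshift1; exact: hS.
Qed.

End lebesgue_rV.

Section fractional_p_laplacian.
Context {R : realType}.

(* The norm `|x| of the library is the sup norm on matrices. *)
Definition enorm N (x : 'rV[R]_N) : R := Num.sqrt (\sum_i x ord0 i ^+ 2).

Definition frac_plap_trunc N (p s : R) (u : 'rV[R]_N -> R) (x : 'rV[R]_N)
    (eps : R) : \bar R :=
  (\int[lebesgue_rV N]_(y in [set y | (eps < enorm (x - y))%R])
     (`|u x - u y| `^ (p - 2) * (u x - u y)
       / enorm (x - y) `^ (N%:R + s * p))%R%:E)%E.

(* [is_frac_plap C p s u x l]: the principal value defining the fractional
   p-Laplacian of u at x, with normalization constant C, exists and gives l. *)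
Definition is_frac_plap N (C p s : R) (u : 'rV[R]_N -> R) (x : 'rV[R]_N)
    (l : R) : Prop :=
  exists2 I : R, frac_plap_trunc p s u x eps @[eps --> 0^'+] --> I%:E
    & l = C * I.

Definition Lp_loc N (q : R) (u : 'rV[R]_N -> R) : Prop :=
  measurable_fun setT u /\
  forall K : set 'rV[R]_N, compact K ->
    (\int[lebesgue_rV N]_(x in K) (`|u x| `^ q)%R%:E < +oo)%E.

Definition Lsp_space N (p s : R) (u : 'rV[R]_N -> R) : Prop :=
  Lp_loc (p - 1) u /\
  (\int[lebesgue_rV N]_x
     (`|1 + u x| `^ (p - 1) / (1 + enorm x `^ (N%:R + s * p)))%R%:E < +oo)%E.

Definition grad N (u : 'rV[R]_N -> R) (x : 'rV[R]_N) : 'rV[R]_N :=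
  \row_i 'D_(delta_mx ord0 i) u x.

(* The Lipschitz condition is in the sup norm, hence equivalent to the
   Euclidean one. *)
Definition C11_loc N (u : 'rV[R]_N -> R) : Prop :=
  (forall x, differentiable u x) /\
  forall K : set 'rV[R]_N, compact K -> [lipschitz grad u x | x in K].

Definition partial1 (f : R -> R -> R) (u v : R) : R := derive1 (f ^~ v) u.
Definition partial2 (f : R -> R -> R) (u v : R) : R := derive1 (f u) v.

(* C^1 on the open quadrant; the values of f elsewhere are irrelevant. *)
Definition C1_quadrant (f : R -> R -> R) : Prop :=
  forall u v, 0 < u -> 0 < v ->
    [/\ derivable (f ^~ v) u 1, derivable (f u) v 1,
        {for (u, v), continuous (fun z : R * R => partial1 f z.1 z.2)} &
        {for (u, v), continuous (fun z : R * R => partial2 f z.1 z.2)}].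

(* w(x) ~ |x|^(-k) as |x| -> oo *)
Definition decays_like N (w : 'rV[R]_N -> R) (k : R) : Prop :=
  exists c C rho : R, [/\ 0 < c, c <= C &
    forall x, rho < enorm x ->
      c * enorm x `^ (- k) <= w x <= C * enorm x `^ (- k)].

Definition radially_symmetric_about N (x0 : 'rV[R]_N) (w : 'rV[R]_N -> R) :=
  forall x y, enorm (x - x0) = enorm (y - x0) -> w x = w y.

Definition radially_decreasing_about N (x0 : 'rV[R]_N) (w : 'rV[R]_N -> R) :=
  forall x y, enorm (x - x0) < enorm (y - x0) -> w y < w x.

End fractional_p_laplacian.

(* Main.v *)
Require Import Defs.
From mathcomp Require Import all_boot all_order all_algebra.
From mathcomp Require Import all_classical all_reals all_analysis.
From mathcomp Require Import measurable_realfun ring lra.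

Set Implicit Arguments.
Unset Strict Implicit.
Unset Printing Implicit Defensive.

Import Order.TTheory GRing.Theory Num.Theory.
Import numFieldNormedType.Exports.

Local Open Scope classical_set_scope.
Local Open Scope ring_scope.

(** The proof is the method of moving planes. Write F (y, z) for
    f y z - a * y `^ (p - 1), so that the first equation says that Cs times the
    fractional p-Laplacian of u equals F (u, v); the second equation has the
    same shape after exchanging u and v. Fix a unit vector e, let x^mu be the
    mirror image of x in the hyperplane x . e = mu, let S_mu be the half-space
    x . e < mu, and put U_mu (x) = u (x^mu) - u x and V_mu (x) = v (x^mu) - v x.

    Comparison. Let x in S_mu be a minimum of U_mu over S_mu with U_mu (x) <= 0.
    Subtract the truncated integrals at x^mu and at x and fold the difference
    onto S_mu by the reflection. The integrand becomes nonpositive, because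
    t |-> `|t| `^ (p - 2) * t is increasing and the kernel is larger at y than
    at y^mu. Hence F (u, v) at x^mu is at most F (u, v) at x ([pde_le]), and if
    U_mu is positive somewhere there is a gain proportional to the distance
    mu - x . e from x to the hyperplane ([pde_near]). Folding needs Lebesgue
    measure to be invariant under every reflection ([lebesgue_rV_refl]), which
    is obtained from translation invariance by the uniqueness argument for Haar
    measure.

    Behaviour at infinity. The y-derivative of F increases with y near 0 and is
    negative at a fixed small y once z is small; so it is at most some - c0 < 0
    for all small y, z > 0 ([source_decr_near0]), whereas the z-derivative
    tends to 0 ([source_flat_near0]). Since u and v tend to 0,
    the comparison shows that at a far negative minimum of U_mu the value of
    V_mu is negative and strictly below that of U_mu ([far_dominatedP]), and
    the same holds with u and v exchanged. Negative minima of U_mu and V_mu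
    therefore cannot both be far away: when U_mu or V_mu takes a negative value
    in S_mu, one of them has a negative minimum in a ball that depends neither
    on mu nor on e ([refl_ge_of_box]). For very negative mu this ball misses
    S_mu, so U_mu and V_mu are nonnegative there.

    Moving the plane. Let lam0 be the supremum of the l such that U_mu and V_mu
    are nonnegative on S_mu for all mu <= l. If U and V do not both vanish
    identically at lam0, they are positive ([strong_maxP]). A negative minimum x
    for mu close to lam0 would then have to lie close to the hyperplane. There
    the gain in the comparison is at least a fixed multiple of mu - x . e, while
    the difference of the values of F is bounded below by - o(mu - x . e), because
    the derivatives of u and v along e are nonnegative on the hyperplane
    ([slope_near], [boundary_freeP]). By compactness the plane moves beyond
    lam0, a contradiction. So u and v are symmetric in the hyperplane of level
    lam0 and strictly increasing across every earlier one
    ([symmetry_direction]).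

    Conclusion. A maximum point x0 of u lies on the symmetry hyperplane of every
    direction. Given x and y, use the direction x - y, for which y is reflected
    onto x: equal distances to x0 give equal values, and unequal distances give
    the strict inequality ([radial_of_directions]). *)

(** * Euclidean geometry of reflections *)

Section euclid.
Context {R : realType} {N : nat}.
Implicit Types (x y z e : 'rV[R]_N) (a b c mu : R).

Definition dot x y : R := \sum_i x ord0 i * y ord0 i.

Lemma dotC x y : dot x y = dot y x.
Proof. by apply: eq_bigr => i _; rewrite mulrC. Qed.

Lemma dotDl x y z : dot (x + y) z = dot x z + dot y z.
Proof. by rewrite -big_split; apply: eq_bigr => i _; rewrite mxE mulrDl. Qed.

Lemma dotZl c x z : dot (c *: x) z = c * dot x z.
Proof. by rewrite mulr_sumr; apply: eq_bigr => i _; rewrite mxE mulrA. Qed.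

Lemma dotDr x y z : dot x (y + z) = dot x y + dot x z.
Proof. by rewrite ![dot x _]dotC dotDl. Qed.

Lemma dotZr c x z : dot x (c *: z) = c * dot x z.
Proof. by rewrite ![dot x _]dotC dotZl. Qed.

Lemma dotNl x y : dot (- x) y = - dot x y.
Proof. by rewrite -scaleN1r dotZl mulN1r. Qed.

Lemma dotNr x y : dot x (- y) = - dot x y.
Proof. by rewrite ![dot x _]dotC dotNl. Qed.

Lemma dot0l x : dot 0 x = 0.
Proof. by rewrite -(scale0r 0) dotZl mul0r. Qed.

Definition dotE := (dotDl, dotDr, dotNl, dotNr, dotZl, dotZr, dot0l).

Lemma dot_ge0 x : 0 <= dot x x.
Proof. by apply: sumr_ge0 => i _; rewrite -expr2 sqr_ge0. Qed.

Lemma dot_eq0 x : dot x x = 0 -> x = 0.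
Proof.
move=> /eqP; rewrite psumr_eq0 => [|i _]; last by rewrite -expr2 sqr_ge0.
move=> /allP h; apply/rowP => i; rewrite mxE; apply/eqP.
by have := h i (mem_index_enum i); rewrite /= mulf_eq0 orbb.
Qed.

Lemma enormE x : enorm x = Num.sqrt (dot x x).
Proof. by []. Qed.

Lemma enorm_ge0 x : 0 <= enorm x.
Proof. exact: sqrtr_ge0. Qed.

Lemma enorm_sqr x : enorm x ^+ 2 = dot x x.
Proof. by rewrite enormE sqr_sqrtr// dot_ge0. Qed.

Lemma enorm0 : enorm (0 : 'rV[R]_N) = 0.
Proof. by rewrite enormE dot0l sqrtr0. Qed.

Lemma enorm_gt0 x : (0 < enorm x) = (x != 0).
Proof.
rewrite lt_neqAle enorm_ge0 andbT eq_sym; congr (~~ _); apply/eqP/eqP.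
  by move=> h; apply: dot_eq0; rewrite -enorm_sqr h expr0n.
by move=> ->; exact: enorm0.
Qed.

Lemma enormN x : enorm (- x) = enorm x.
Proof. by rewrite !enormE !dotE opprK. Qed.

Lemma enorm_le x y : (enorm x <= enorm y) = (dot x x <= dot y y).
Proof. by rewrite !enormE ler_sqrt// dot_ge0. Qed.

Lemma le_enorm c x : 0 <= c -> (c <= enorm x) = (c ^+ 2 <= dot x x).
Proof. by move=> c0; rewrite -enorm_sqr ler_sqr// nnegrE// enorm_ge0. Qed.

Lemma dot_le_enorm e x : dot e e = 1 -> `|dot x e| <= enorm x.
Proof.
move=> e1; rewrite le_enorm// real_normK ?num_real//.
have := dot_ge0 (x - dot x e *: e).
by rewrite !dotE e1 (dotC e x); lra.
Qed.

(** Reflection in the hyperplane x . e = mu when e is a unit vector. *)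
Definition refl e mu x := x + (2 * (mu - dot x e)) *: e.

Section unit.
Variables (e : 'rV[R]_N) (mu : R).
Hypothesis e1 : dot e e = 1.

Lemma dot_refl x : dot (refl e mu x) e = 2 * mu - dot x e.
Proof. by rewrite /refl !dotE e1; ring. Qed.

Lemma reflK : involutive (refl e mu).
Proof.
move=> x; rewrite {1}/refl dot_refl /refl -addrA -scalerDl.
have -> : 2 * (mu - dot x e) + 2 * (mu - (2 * mu - dot x e)) = 0 by ring.
by rewrite scale0r addr0.
Qed.

Lemma refl_fix x : dot x e = mu -> refl e mu x = x.
Proof. by move=> xe; rewrite /refl xe subrr mulr0 scale0r addr0. Qed.

(** The increase of the squared distance is four times the product of the
    signed distances of the two points to the hyperplane; the kernel estimates
    near the hyperplane rest on this exact value. *)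
Lemma dot_sub_refl x y : dot (x - refl e mu y) (x - refl e mu y) =
  dot (x - y) (x - y) + 4 * (mu - dot x e) * (mu - dot y e).
Proof.
rewrite /refl !dotE e1 (dotC e x) (dotC e y); ring.
Qed.

Lemma enorm_refl x y : enorm (refl e mu x - refl e mu y) = enorm (x - y).
Proof.
rewrite !enormE dot_sub_refl; congr Num.sqrt.
have -> : dot (refl e mu x - y) (refl e mu x - y) =
          dot (y - refl e mu x) (y - refl e mu x).
  by rewrite -[RHS]opprK -dotNl -dotNr opprB.
rewrite dot_sub_refl dot_refl.
by rewrite !dotE (dotC x y); ring.
Qed.

Lemma enorm_sub_refl_ge x y : dot x e < mu -> dot y e <= mu ->
  mu - dot x e <= enorm (x - refl e mu y).
Proof.
move=> xe ye; rewrite le_enorm; last by lra.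
have := dot_le_enorm (x - refl e mu y) e1.
rewrite le_enorm// real_normK ?num_real//; apply: le_trans.
rewrite dotDl dotNl dot_refl.
have : 0 <= mu - dot y e by lra.
have : 0 <= mu - dot x e by lra.
by move: (dot x e) (dot y e) => a b *; nra.
Qed.

Lemma enorm_sub_refl_le x y : dot x e <= mu -> dot y e <= mu ->
  enorm (x - y) <= enorm (x - refl e mu y).
Proof.
move=> xe ye; rewrite enorm_le dot_sub_refl lerDl.
by rewrite -mulrA mulr_ge0// mulr_ge0//; lra.
Qed.

End unit.

(** Does the work of a triangle inequality where constants are irrelevant. *)
Lemma dot_addr_le x y : dot (x + y) (x + y) <= 2 * dot x x + 2 * dot y y.
Proof. by have := dot_ge0 (x - y); rewrite !dotE (dotC y x); lra. Qed.

End euclid.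

(** * Lebesgue measure is invariant under reflections *)

(** The image measure bundled as a measure, the form in which uniqueness
    theorems for measures can be applied to it. *)
Definition pushforward_measure d1 d2 (T1 : measurableType d1)
    (T2 : measurableType d2) (R : realType) (m : {measure set T1 -> \bar R})
    (f : T1 -> T2) (mf : measurable_fun setT f) :
    {measure set T2 -> \bar R} :=
  measure_function_pushforward__canonical__measure_function_Measure m mf.

Section translation.
Context {R : realType}.

Lemma measurable_addr (c : R) :
  measurable_fun [set: measurableTypeR R]
    (fun x : measurableTypeR R => x + c : measurableTypeR R).
Proof. by apply: measurable_funD => //; exact: measurable_id. Qed.

Lemma lebesgue_measure_addr (c : R) (A : set (measurableTypeR R)) :
  measurable A ->
  @lebesgue_measure R [set x | A (x + c)] = lebesgue_measure A.
Proof.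
move=> mA; pose m' := pushforward_measure (@lebesgue_measure R) (measurable_addr c).
suff m'E X : ocitv X -> lebesgue_measure X = m' X.
  by rewrite (lebesgue_measure_unique m'E mA).
move=> [[a b] _ <-] /=; rewrite /pushforward.
rewrite (_ : _ @^-1` _ = `]a - c, b - c]%classic); last first.
  by apply/seteqP; split=> x /=; rewrite !in_itv/= ltrBlDr lerBrDr.
rewrite !lebesgue_measure_itv/= !lte_fin ltrD2r; case: ifP => // _.
by rewrite -!EFinD; congr EFin; ring.
Qed.

Lemma measurable_rV_addr n (c : 'rV[R]_n) :
  measurable_fun [set: 'rV[R]_n] (fun x => x + c).
Proof.
apply/measurable_fun_rVP => i.
under eq_fun do rewrite mxE.
by apply: measurable_funD => //; exact: measurable_coord.
Qed.

Lemma rV_consl n (z : measurableTypeR R * 'rV[R]_n) (j : 'I_1) :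
  rV_cons z ord0 (lshift n j) = z.1.
Proof. by apply: etrans (row_mxEl _ _ _ _) _; rewrite mxE. Qed.

Lemma rV_consr n (z : measurableTypeR R * 'rV[R]_n) (j : 'I_n) :
  rV_cons z ord0 (rshift 1 j) = z.2 ord0 j.
Proof. exact: row_mxEr. Qed.

Lemma measurable_rV_cons n :
  measurable_fun [set: measurableTypeR R * 'rV[R]_n] (@rV_cons R n).
Proof.
apply/measurable_fun_rVP => i; case: (split_ordP (i : 'I_(1 + n))) => j ->.
  by under eq_fun do rewrite rV_consl; exact: measurable_fst.
under eq_fun do rewrite rV_consr.
exact: (measurableT_comp (measurable_coord j) measurable_snd).
Qed.

Lemma rV_consD n (z w : measurableTypeR R * 'rV[R]_n) :
  rV_cons z + rV_cons w = rV_cons (z.1 + w.1 : measurableTypeR R, z.2 + w.2).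
Proof.
apply/rowP => i; rewrite mxE; case: (split_ordP (i : 'I_(1 + n))) => j ->.
  by rewrite !rV_consl.
by rewrite !rV_consr mxE.
Qed.

Lemma rV_cons_surj n (x : 'rV[R]_n.+1) : exists z, x = rV_cons z.
Proof.
exists (x ord0 ord0 : measurableTypeR R, rsubmx (x : 'rV_(1 + n))).
apply/rowP => i; case: (split_ordP (i : 'I_(1 + n))) => j ->.
  by rewrite rV_consl ord1; congr (x _ _); exact: val_inj.
by rewrite rV_consr mxE.
Qed.

(** Induction on the dimension: translation preserves the product measure of
    rectangles, and these determine a product of sigma-finite measures. *)
Lemma lebesgue_rV_addr n (c : 'rV[R]_n) (A : set 'rV[R]_n) : measurable A ->
  lebesgue_rV n [set x | A (x + c)] = lebesgue_rV n A.
Proof.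
elim: n c A => [|n IH] c A mA.
  by congr (lebesgue_rV 0 _); apply/seteqP; split=> x; rewrite /= (thinmx0 (x + c)) (thinmx0 x).
have [w ->] := rV_cons_surj c.
pose mu := lebesgue_rV (R:=R) n.
pose tr (z : measurableTypeR R * 'rV[R]_n) := 
  (z.1 + w.1 : measurableTypeR R, z.2 + w.2).
have mtr : measurable_fun setT tr.
  apply/measurable_fun_pairP; split.
    exact: (measurableT_comp (measurable_addr w.1) measurable_fst).
  exact: (measurableT_comp (measurable_rV_addr w.2) measurable_snd).
have mA' : measurable (@rV_cons R n @^-1` A).
  by rewrite -[X in measurable X]setTI; exact: measurable_rV_cons.
transitivity ((@lebesgue_measure R \x mu)%E (tr @^-1` (@rV_cons R n @^-1` A))).
  rewrite /= /pushforward; congr (_ _).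
  by apply/seteqP; split=> z /=; rewrite rV_consD.
pose m' := pushforward_measure (@lebesgue_measure R \x mu)%E mtr.
suff m'E B C : measurable B -> measurable C ->
    m' (B `*` C) = (@lebesgue_measure R B * mu C)%E.
  by rewrite /= /pushforward (product_measure_unique m'E mA').
move=> mB mC.
rewrite /= /pushforward.
rewrite (_ : tr @^-1` _ = [set x | B (x + w.1)] `*` [set x | C (x + w.2)])//.
rewrite product_measure1E.
- by congr (_ * _)%E; [exact: lebesgue_measure_addr | exact: IH].
- by rewrite -[X in measurable X]setTI; exact: measurable_addr.
- by rewrite -[X in measurable X]setTI; exact: measurable_rV_addr.
Qed.

End translation.

(** Both iterated integrals define the product measure, because they agree on
    rectangles. *)
Lemma integral_sections d1 d2 (T1 : measurableType d1) (T2 : measurableType d2)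
    (R : realType) (m1 : {sigma_finite_measure set T1 -> \bar R})
    (m2 : {sigma_finite_measure set T2 -> \bar R}) (E : set (T1 * T2)) :
  measurable E ->
  (\int[m1]_x m2 (xsection E x) = \int[m2]_y m1 (ysection E y))%E.
Proof.
move=> mE; have H : forall B C, measurable B -> measurable C ->
    (m1 \x^ m2)%E (B `*` C) = (m1 B * m2 C)%E.
  by move=> B C mB mC; rewrite product_measure2E.
exact: (product_measure_unique H mE).
Qed.

Section reflection.
Context {R : realType} {N : nat}.
Implicit Types (x y e : 'rV[R]_N) (A B : set 'rV[R]_N) (mu : R).
Local Notation lam := (lebesgue_rV N).

Lemma measurable_dot e : measurable_fun [set: 'rV[R]_N] (dot ^~ e).
Proof.
apply: measurable_sum => i.
by apply: measurable_funM => //; exact: measurable_coord.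
Qed.

Lemma measurable_refl e mu : measurable_fun [set: 'rV[R]_N] (refl e mu).
Proof.
apply/measurable_fun_rVP => i; under eq_fun do rewrite !mxE.
apply: measurable_funD; first exact: measurable_coord.
apply: measurable_funM => //; apply: measurable_funM => //.
by apply: measurable_funB => //; exact: measurable_dot.
Qed.

Lemma measurable_enorm : measurable_fun [set: 'rV[R]_N] (@enorm R N).
Proof.
apply: (@measurableT_comp _ _ _ _ _ _ (@Num.sqrt R)).
  by apply: continuous_measurable_fun; exact: sqrt_continuous.
apply: measurable_sum => i.
by apply: measurable_funX; exact: measurable_coord.
Qed.

Lemma measurable_preimage_rV (f : 'rV[R]_N -> 'rV[R]_N) A :
  measurable_fun setT f -> measurable A -> measurable (f @^-1` A).
Proof. by move=> mf mA; rewrite -[X in measurable X]setTI; exact: mf. Qed.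

Lemma lebesgue_rV_cube (c : 'rV[R]_N) (h : R) : 0 < h ->
  lam [set x | forall i, x ord0 i \in `[c ord0 i - h, c ord0 i + h]] =
  ((h *+ 2) ^+ N)%:E.
Proof.
move=> h0.
rewrite (lebesgue_rV_box (A := fun i => `[c ord0 i - h, c ord0 i + h]%classic)) //.
rewrite (eq_bigr (fun=> (h *+ 2)%:E)) => [{c}|i _].
  rewrite big_const_ord; elim: N => [|k IH] //=.
  by rewrite IH -EFinM -exprS.
rewrite lebesgue_measure_itv/= lte_fin ifT; last by lra.
by rewrite -EFinD; congr EFin; ring.
Qed.

Lemma measurable_cube (c : 'rV[R]_N) (h : R) :
  measurable [set x : 'rV[R]_N | forall i, x ord0 i \in `[c ord0 i - h, c ord0 i + h]].
Proof.
rewrite (_ : [set _ | _] = \bigcap_(i in [set: 'I_N])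
    ((fun x : 'rV[R]_N => x ord0 i) @^-1` `[c ord0 i - h, c ord0 i + h])); last first.
  by apply/seteqP; split=> x /= hx i; [move=> _|]; exact: hx.
apply: fin_bigcap_measurable => // i _.
by rewrite -[X in measurable X]setTI; exact: measurable_coord.
Qed.

Lemma coord_le_enorm x i : `|x ord0 i| <= enorm x.
Proof.
rewrite le_enorm// real_normK ?num_real// /dot (bigD1 i)//= -expr2 lerDl.
by apply: sumr_ge0 => j _; rewrite -expr2 sqr_ge0.
Qed.

Lemma enorm_le_coord x h : (forall i, `|x ord0 i| <= h) ->
  dot x x <= N%:R * h ^+ 2.
Proof.
move=> hx; rewrite mulr_natl -[X in _ *+ X]card_ord -sumr_const.
apply: ler_sum => i _; rewrite -expr2 -[leLHS]real_normK ?num_real//.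
by rewrite lerXn2r// nnegrE// (le_trans _ (hx i)).
Qed.

Lemma measurable_enormB x : measurable_fun [set: 'rV[R]_N] (fun y => enorm (x - y)).
Proof.
rewrite (_ : (fun _ => _) = (@enorm R N) \o (fun y => y + - x)); last first.
  by apply/funext => y /=; rewrite -enormN opprB.
exact: measurableT_comp measurable_enorm (measurable_rV_addr _).
Qed.

Lemma measurable_eball x (h : R) : measurable [set y | enorm (x - y) <= h].
Proof.
rewrite (_ : [set _ | _] = (fun y => enorm (x - y)) @^-1` [set` (Interval -oo%O (BRight h))]).
  by rewrite -[X in measurable X]setTI; exact: measurable_enormB.
by apply/seteqP; split=> y; rewrite /= in_itv.
Qed.

Lemma lebesgue_rV_eball_le x (h : R) : 0 < h ->
  (lam [set y | (enorm (x - y) <= h)%R] <= ((h *+ 2) ^+ N)%:E)%E.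
Proof.
move=> h0; rewrite -(lebesgue_rV_cube x h0); apply: le_measure; rewrite ?inE.
- exact: measurable_eball.
- exact: measurable_cube.
move=> y /= xyh i; have := le_trans (coord_le_enorm (x - y) i) xyh.
by rewrite !mxE ler_norml in_itv/=; lra.
Qed.

Lemma lebesgue_rV_eball_gt0 : (0 < lam [set y : 'rV[R]_N | (enorm (0 - y) <= 1)%R])%E.
Proof.
pose h : R := N.+1%:R^-1; have h0 : 0 < h by rewrite invr_gt0.
apply: (@lt_le_trans _ _ ((h *+ 2) ^+ N)%:E).
  by rewrite lte_fin exprn_gt0// mulrn_wgt0.
rewrite -(lebesgue_rV_cube 0 h0); apply: le_measure; rewrite ?inE.
- exact: measurable_cube.
- exact: measurable_eball.
move=> y /= yh; rewrite sub0r enormN -(ler_sqr (enorm_ge0 _))//; last exact: ler01.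
rewrite enorm_sqr expr1n.
apply: (le_trans (enorm_le_coord (h := h) _)) => [i|].
  by have := yh i; rewrite !mxE in_itv/= ler_norml; lra.
rewrite /h exprVn ler_pdivrMr ?exprn_gt0// mul1r -natrX ler_nat.
by rewrite (leq_trans (leqnSn N))// expnS expn1 leq_pmulr.
Qed.

(** The uniqueness argument for Haar measure. With T the linear reflection and A
    the unit ball, measure the set of pairs (x, y) with T x in A and T x + y in B
    in both orders. Integrating first over y gives lam B * lam A. For fixed y,
    T x + y = T (x + T y), so a translation in x turns the conditions into
    T x - y in A and T x in B, and the other order gives
    lam (T @^-1` B) * lam A, as A = - A. Finally 0 < lam A < +oo. *)
Lemma lebesgue_rV_refl0 e B : dot e e = 1 -> measurable B ->
  lam (refl e 0 @^-1` B) = lam B.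
Proof.
move=> e1 mB; pose T := refl e 0; pose A := [set y : 'rV[R]_N | enorm (0 - y) <= 1].
have mT : measurable_fun setT T by exact: measurable_refl.
have mA : measurable A by exact: measurable_eball.
have TD x y : T (x + y) = T x + T y.
  by rewrite /T /refl !dotE !sub0r opprD mulrDr scalerDl addrACA.
have TK y : T (T y) = y by exact: reflK.
have T0 : T 0 = 0 by rewrite /T refl_fix// dot0l.
have TA : T @^-1` A = A.
  have nT y : enorm (0 - T y) = enorm (0 - y) by rewrite -{1}T0 enorm_refl.
  by apply/seteqP; split=> y; rewrite /A /= nT.
have AN x y : A (x - y) <-> A (y - x).
  by rewrite /A /= !sub0r !opprB -enormN opprB.
pose E := [set z : 'rV[R]_N * 'rV[R]_N | A (T z.1) /\ B (T z.1 + z.2)].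
pose E' := [set z : 'rV[R]_N * 'rV[R]_N | A (T z.1 - z.2) /\ B (T z.1)].
have mT1 : measurable_fun setT (fun z : 'rV[R]_N * 'rV[R]_N => T z.1).
  exact: measurableT_comp mT measurable_fst.
have mpre (g : 'rV[R]_N * 'rV[R]_N -> 'rV[R]_N) C :
    measurable_fun setT g -> measurable C -> measurable (g @^-1` C).
  by move=> mg mC; rewrite -[X in measurable X]setTI; exact: mg.
have mcomb (k : R) : measurable_fun setT
    (fun z : 'rV[R]_N * 'rV[R]_N => T z.1 + k *: z.2).
  apply/measurable_fun_rVP => i; under eq_fun do rewrite mxE [X in _ + X]mxE.
  apply: measurable_funD.
    exact: measurableT_comp (measurable_coord i) mT1.
  apply: measurable_funM => //.
  exact: measurableT_comp (measurable_coord i) measurable_snd.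
have mE : measurable E.
  rewrite (_ : E = ((fun z => T z.1) @^-1` A) `&`
                   ((fun z => T z.1 + 1 *: z.2) @^-1` B)).
    by apply: measurableI; apply: mpre.
  by apply/seteqP; split=> z; rewrite /E/= scale1r.
have mE' : measurable E'.
  rewrite (_ : E' = ((fun z => T z.1 + (-1) *: z.2) @^-1` A) `&`
                    ((fun z => T z.1) @^-1` B)).
    by apply: measurableI; apply: mpre.
  by apply/seteqP; split=> z; rewrite /E'/= scaleN1r.
have E1 : (\int[lam]_x lam (xsection E x) = lam B * lam A)%E.
  rewrite (eq_integral (fun x => lam B * (\1_A x)%:E)%E) => [|x _].
    rewrite ge0_integralZl//; first by rewrite integral_indic// setIT.
    exact/measurable_EFinP/measurable_indic.
  have [xA|xA] := boolP (x \in A).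
    rewrite indicE xA mule1 -(lebesgue_rV_addr (T x) mB); congr (lam _).
    apply/seteqP; split=> y; rewrite /xsection/= inE/E/=.
      by case=> _; rewrite addrC.
    by rewrite addrC; split=> //; rewrite -[A _]/((T @^-1` A) x) TA -inE.
  rewrite indicE (negbTE xA) mule0 (_ : xsection E x = set0) ?measure0//.
  apply/seteqP; split=> // y; rewrite /xsection/= inE/E/= => -[+ _].
  by rewrite -[A _]/((T @^-1` A) x) TA -inE (negbTE xA).
have E2 : (\int[lam]_y lam (ysection E y) = \int[lam]_y lam (ysection E' y))%E.
  apply: eq_integral => y _.
  rewrite -(lebesgue_rV_addr (T y) (measurable_ysection y mE')); congr (lam _).
  apply/seteqP; split=> x; rewrite /ysection/= !inE/E/E'/= TD TK.
    by rewrite addrK.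
  by rewrite addrK.
have E3 : (\int[lam]_x lam (xsection E' x) = lam (T @^-1` B) * lam A)%E.
  rewrite (eq_integral (fun x => lam A * (\1_(T @^-1` B) x)%:E)%E) => [|x _].
    rewrite ge0_integralZl//.
    - rewrite integral_indic ?setIT 1?muleC//; exact: measurable_preimage_rV.
    - by apply/measurable_EFinP/measurable_indic; exact: measurable_preimage_rV.
  have [xB|xB] := boolP (x \in T @^-1` B).
    rewrite indicE xB mule1 -(lebesgue_rV_addr (- T x) mA); congr (lam _).
    apply/seteqP; split=> y; rewrite /xsection/= inE/E'/=.
      by move=> -[/AN].
    by move=> /AN; split => //; rewrite inE in xB.
  rewrite indicE (negbTE xB) mule0 (_ : xsection E' x = set0) ?measure0//.
  apply/seteqP; split=> // y; rewrite /xsection/= inE/E'/= => -[_ xB'].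
  by move: xB; rewrite notin_setE.
have Afin : lam A \is a fin_num.
  rewrite ge0_fin_numE//; apply: (le_lt_trans (lebesgue_rV_eball_le 0 ltr01)).
  by rewrite ltry.
have A0 : (0 < lam A)%E by exact: lebesgue_rV_eball_gt0.
have : (lam (T @^-1` B) * lam A = lam B * lam A)%E.
  by rewrite -E3 -E1 !integral_sections.
rewrite -(fineK Afin) => /(congr1 (fun z => z * (fine (lam A))^-1%:E)%E).
have fA0 : 0 < fine (lam A) by rewrite fine_gt0// A0 -ge0_fin_numE.
by rewrite -!muleA -EFinM divff ?gt_eqF// !mule1.
Qed.

Lemma lebesgue_rV_refl e mu B : dot e e = 1 -> measurable B ->
  lam (refl e mu @^-1` B) = lam B.
Proof.
move=> e1 mB; rewrite -(lebesgue_rV_addr ((2 * mu) *: e) mB).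
rewrite -[RHS](lebesgue_rV_refl0 e1); last first.
  exact: (measurable_preimage_rV (measurable_rV_addr _)).
congr (lam _); apply/seteqP; split=> x /=;
  by rewrite /refl -addrA -scalerDl sub0r (_ : _ + _ = 2 * (mu - dot x e))//; ring.
Qed.

End reflection.

(** * The odd power and the kernel *)

Section power.
Context {R : realType}.
Implicit Types (p c t A B alpha d L : R).

(** The nonlinearity of the fractional p-Laplacian. *)
Definition spow p t := `|t| `^ (p - 2) * t.

Lemma spowN p t : spow p (- t) = - spow p t.
Proof. by rewrite /spow normrN mulrN. Qed.

Lemma spow_gap0 p c A B : 2 < p -> 0 <= c -> 0 <= A -> A + c <= B ->
  c `^ (p - 2) * c <= spow p B - spow p A.
Proof.
move=> p2 c0 A0 AB; have B0 : 0 <= B by lra.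
rewrite /spow !ger0_norm//.
have q0 : 0 <= p - 2 by lra.
have hA : A `^ (p - 2) <= B `^ (p - 2) by rewrite ge0_ler_powR ?nnegrE//; lra.
have hc : c `^ (p - 2) <= B `^ (p - 2) by rewrite ge0_ler_powR ?nnegrE//; lra.
have := powR_ge0 A (p - 2); have := powR_ge0 c (p - 2).
move: (A `^ _) (B `^ _) (c `^ _) hA hc => a b d hA hc a0 d0; nra.
Qed.

(** The constant is halved to cover A < 0 < B, where only the larger of B and
    - A is known to be at least c / 2. *)
Lemma spow_gap p c A B : 2 < p -> 0 <= c -> A + c <= B ->
  (c / 2) `^ (p - 2) * (c / 2) <= spow p B - spow p A.
Proof.
move=> p2 c0 AB; have c2 : 0 <= c / 2 by lra.
have s0 : spow p 0 = 0 by rewrite /spow mulr0.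
have gap0 a z : 0 <= a -> a <= z -> a `^ (p - 2) * a <= spow p z.
  move=> a0 az; have z0 : 0 + a <= z by rewrite add0r.
  by have := spow_gap0 p2 a0 (lexx 0) z0; rewrite s0 subr0.
have [A0|A0] := leP 0 A.
  have AB' : A + c / 2 <= B by lra.
  exact: spow_gap0 p2 c2 A0 AB'.
have [B0|B0] := leP B 0.
  have BN : 0 <= - B by lra.
  have AB' : - B + c / 2 <= - A by lra.
  by have := spow_gap0 p2 c2 BN AB'; rewrite !spowN opprK [leRHS]addrC.
have hA : 0 <= - A by lra.
have := gap0 0 _ (lexx 0) hA; rewrite mulr0 spowN => gA.
have := gap0 0 _ (lexx 0) (ltW B0); rewrite mulr0 => gB.
have [cB|cA] := leP (c / 2) B.
  by rewrite -[leLHS]addr0 lerD// gap0.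
rewrite -[leLHS]add0r lerD// -spowN gap0//; lra.
Qed.

Lemma spow_le p A B : 2 < p -> A <= B -> spow p A <= spow p B.
Proof.
move=> p2 AB; have := spow_gap p2 (le_refl 0) (_ : A + 0 <= B).
by rewrite addr0 mul0r mulr0 subr_ge0; apply.
Qed.

Lemma spow_bound p t M : 2 < p -> `|t| <= M -> `|spow p t| <= spow p M.
Proof.
move=> p2; rewrite ler_norml => /andP[tM tM'].
by rewrite ler_norml -spowN !spow_le.
Qed.

Lemma spow_ge0 p t : 0 <= t -> 0 <= spow p t.
Proof. by move=> t0; rewrite mulr_ge0// powR_ge0. Qed.

Lemma measurable_spow p : measurable_fun [set: R] (spow p).
Proof.
apply: measurable_funM => //.
exact: measurableT_comp (measurable_powR _) _.
Qed.

Lemma ker_le alpha d d' : 0 <= alpha -> 0 < d -> d <= d' ->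
  (d' `^ alpha)^-1 <= (d `^ alpha)^-1.
Proof.
move=> a0 d0 dd'; rewrite lef_pV2 ?posrE ?powR_gt0//; last exact: lt_le_trans dd'.
by rewrite ge0_ler_powR// nnegrE ltW//; exact: lt_le_trans dd'.
Qed.

(** As alpha >= 2, the difference d' `^ alpha - d `^ alpha is at least
    (d' ^+ 2 - d ^+ 2) * d' `^ (alpha - 2). Squared distances are kept since
    their difference under a reflection is explicit. *)
Lemma ker_gap alpha d d' L : 2 <= alpha -> 0 < d -> d <= d' -> d' <= L ->
  (d' ^+ 2 - d ^+ 2) / (L ^+ 2 * L `^ alpha) <=
  (d `^ alpha)^-1 - (d' `^ alpha)^-1.
Proof.
move=> a2 d0 dd' d'L.
have d'0 : 0 < d' by exact: lt_le_trans dd'.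
have L0 : 0 < L by exact: lt_le_trans d'L.
have split_pow z : 0 < z -> z `^ alpha = z ^+ 2 * z `^ (alpha - 2).
  move=> z0; rewrite -powR_mulrn ?ltW// -powRD; last by rewrite (gt_eqF z0) implybT.
  by congr (_ `^ _); ring.
have hd : d `^ (alpha - 2) <= d' `^ (alpha - 2).
  by rewrite ge0_ler_powR ?nnegrE//; lra.
have da0 : 0 < d `^ alpha by rewrite powR_gt0.
have d'a0 : 0 < d' `^ alpha by rewrite powR_gt0.
have gap : (d' ^+ 2 - d ^+ 2) * d' `^ (alpha - 2) <= d' `^ alpha - d `^ alpha.
  rewrite !split_pow// mulrBl lerD2l lerN2 ler_wpM2l// sqr_ge0//.
have dL : d `^ alpha <= L `^ alpha by rewrite ge0_ler_powR ?nnegrE//; lra.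
have d'L2 : d' ^+ 2 <= L ^+ 2 by rewrite lerXn2r ?nnegrE//; lra.
have -> : (d `^ alpha)^-1 - (d' `^ alpha)^-1 =
    (d' `^ alpha - d `^ alpha) / (d `^ alpha * d' `^ alpha).
  by field; rewrite !gt_eqF.
apply: (@le_trans _ _ ((d' ^+ 2 - d ^+ 2) * d' `^ (alpha - 2) /
    (d `^ alpha * d' `^ alpha))); last first.
  by rewrite ler_wpM2r// invr_ge0 mulr_ge0// ltW.
have dd2 : 0 <= d' ^+ 2 - d ^+ 2 by rewrite subr_ge0 lerXn2r ?nnegrE//; lra.
have -> : (d' ^+ 2 - d ^+ 2) * d' `^ (alpha - 2) / (d `^ alpha * d' `^ alpha) =
   (d' ^+ 2 - d ^+ 2) / (d' ^+ 2 * d `^ alpha).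
  have d'20 : 0 < d' `^ (alpha - 2) by rewrite powR_gt0.
  rewrite (split_pow d')//; field; rewrite !gt_eqF//.
apply: ler_wpM2l => //.
rewrite lef_pV2 ?posrE ?mulr_gt0 ?exprn_gt0 ?powR_gt0//.
by apply: ler_pM => //; rewrite ?sqr_ge0// powR_ge0.
Qed.

End power.

(** * Truncated integrals and reflections *)

Section integral_reflection.
Context {R : realType} {N : nat} (e : 'rV[R]_N) (mu : R).
Hypothesis e1 : dot e e = 1.
Local Notation lam := (lebesgue_rV N).
Local Notation T := (refl e mu).
Implicit Types (W : 'rV[R]_N -> R).

Let lamT := pushforward_measure lam (measurable_refl e mu).

Let lamTE (A : set 'rV[R]_N) : measurable A -> A `<=` setT -> lamT A = lam A.
Proof. by move=> mA _; exact: lebesgue_rV_refl. Qed.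

Lemma integrable_refl W : lam.-integrable setT (EFin \o W) ->
  lam.-integrable setT (EFin \o (W \o T)).
Proof.
move=> iW; have mW : measurable_fun setT W.
  by apply/measurable_EFinP; case/integrableP : iW.
have mWT : measurable_fun setT (EFin \o (W \o T)).
  by apply/measurable_EFinP; exact: measurableT_comp (measurable_refl _ _).
apply/integrableP; split => //.
case/integrableP : iW => _; congr (_ < _)%E.
rewrite -(eq_measure_integral lam lamTE) ge0_integral_pushforward//.
- exact: measurable_refl.
- by apply: measurableT_comp => //; exact/measurable_EFinP.
Qed.

Lemma integral_refl W : lam.-integrable setT (EFin \o W) ->
  (\int[lam]_y (W (T y))%:E = \int[lam]_y (W y)%:E)%E.
Proof.
move=> iW; have iWT := integrable_refl iW.
have mW : measurable_fun setT (EFin \o (W \o T)) by case/integrableP : iWT.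
rewrite -(eq_measure_integral lam lamTE) integral_pushforward//.
- by apply: eq_integral => y _ /=; rewrite reflK.
- exact: measurable_refl.
- rewrite preimage_setT; apply: eq_integrable iW => // y _ /=.
  by rewrite reflK.
Qed.

(** W and its reflection have the same integral, so only the sum of W over pairs
    of mirror points matters. In this form points of the hyperplane, which are
    their own mirror images, need no separate null-set argument. *)
Lemma integral_sym_le0 W : lam.-integrable setT (EFin \o W) ->
  (forall y, W y + W (T y) <= 0) -> \int[lam]_y W y <= 0.
Proof.
move=> iW WT.
have E : \int[lam]_y (W y + W (T y)) = 2 * \int[lam]_y W y.
  rewrite RintegralD//; last exact: integrable_refl.
  by rewrite /Rintegral integral_refl// mulr_natl.
rewrite -(pmulr_rle0 _ (ltr0n R 2)) -E.
have <- : \int[lam]_(y in setT) (0 : R) = 0 by rewrite Rintegral_cst// mul0r.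
apply: le_Rintegral => //.
- apply: (integrableD measurableT iW (integrable_refl iW)).
- exact: integrable0.
Qed.

End integral_reflection.

Section truncated.
Context {R : realType} {N : nat}.
Variables (p s M : R) (u : 'rV[R]_N -> R).
Local Notation lam := (lebesgue_rV N).
Local Notation alpha := (N%:R + s * p).
Implicit Types (x y e : 'rV[R]_N) (w : 'rV[R]_N -> R) (mu eps : R).

(** Extending the truncated kernel by 0 replaces the varying domains of the
    truncated integrals by the whole space, on which reflections act. *)
Definition cutker eps x y : R :=
  if eps < enorm (x - y) then (enorm (x - y) `^ alpha)^-1 else 0.

Definition plap_cut (w0 : R) w x eps y : R := spow p (w0 - w y) * cutker eps x y.

Hypothesis p2 : 2 < p.
Hypothesis ker_int : forall eps x, 0 < eps ->
  lam.-integrable setT (EFin \o cutker eps x).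

Lemma cutker_ge0 eps x y : 0 <= cutker eps x y.
Proof. by rewrite /cutker; case: ifP => // _; rewrite invr_ge0 powR_ge0. Qed.

Lemma cutkerE eps x y : eps < enorm (x - y) ->
  cutker eps x y = (enorm (x - y) `^ alpha)^-1.
Proof. by rewrite /cutker => ->. Qed.

Lemma cutker0 eps x y : enorm (x - y) <= eps -> cutker eps x y = 0.
Proof. by rewrite /cutker leNgt => /negbTE ->. Qed.

Lemma integrable_plap_cut (w0 : R) w x eps : 0 < eps -> measurable_fun setT w ->
  `|w0| <= M -> (forall y, `|w y| <= M) ->
  lam.-integrable setT (EFin \o plap_cut w0 w x eps).
Proof.
move=> eps0 mw w0M wM.
have ik := integrableZl measurableT (spow p (2 * M)) (ker_int x eps0).
apply: le_integrable ik => //.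
  apply/measurable_EFinP; apply: measurable_funM.
    apply: measurableT_comp (measurable_spow p) _.
    exact: measurable_funB.
  by apply/measurable_EFinP; case/integrableP : (ker_int x eps0).
move=> y _ /=; rewrite lee_fin normrM [leRHS]normrM ler_wpM2r// [leRHS]ger0_norm; last first.
  by rewrite spow_ge0// mulr_ge0// (le_trans _ w0M).
apply: spow_bound => //; apply: (le_trans (ler_normB _ _)).
by rewrite mulr_natl lerD.
Qed.

Lemma frac_plap_truncE x eps :
  frac_plap_trunc p s u x eps = (\int[lam]_y (plap_cut (u x) u x eps y)%:E)%E.
Proof.
rewrite /frac_plap_trunc integral_mkcond; apply: eq_integral => y _.
rewrite patchE /plap_cut; case: ifPn; [rewrite inE/=|rewrite notin_setE/=] => h.
  by rewrite cutkerE.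
by rewrite cutker0 ?mulr0// leNgt; exact/negP.
Qed.

Hypothesis meas_u : measurable_fun setT u.
Hypothesis uM : forall y, `|u y| <= M.

(** A reflection is an isometry, so it carries the truncation around the mirror
    image of x to the truncation around x; the two integrals to be compared
    then share one kernel. *)
Lemma frac_plap_trunc_refl e mu x eps : dot e e = 1 -> 0 < eps ->
  frac_plap_trunc p s u (refl e mu x) eps =
  (\int[lam]_y (plap_cut (u (refl e mu x)) (u \o refl e mu) x eps y)%:E)%E.
Proof.
move=> e1 eps0; rewrite frac_plap_truncE.
pose W := plap_cut (u (refl e mu x)) u (refl e mu x) eps.
have iW : lam.-integrable setT (EFin \o W) by exact: integrable_plap_cut.
rewrite -[LHS](integral_refl mu e1 iW); apply: eq_integral => y _.
by rewrite /W /plap_cut /cutker enorm_refl.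
Qed.

End truncated.

(** The values are paired crosswise: the left side equals
    z - (a2 - a1) * (k - k') - ((b2 - a1) + (a2 - b1)) * k'. *)
Lemma folded_sum_le0 (R : realType) (a1 a2 b1 b2 k k' z : R) :
  a1 <= b2 -> b1 <= a2 -> 0 <= k' -> z <= (a2 - a1) * (k - k') ->
  a1 * k - a2 * k + z + (b1 - b2) * k' <= 0.
Proof.
move=> ab ba k'0 zgap.
have pairing : 0 <= ((b2 - a1) + (a2 - b1)) * k'.
  by rewrite mulr_ge0// addr_ge0// subr_ge0.
by lra.
Qed.

(** * Comparison at a nonpositive minimum of the reflected difference *)

Section comparison.
Context {R : realType} {N : nat}.
Variables (p s M : R) (u : 'rV[R]_N -> R).
Local Notation lam := (lebesgue_rV N).
Local Notation alpha := (N%:R + s * p).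
Hypothesis N0 : (0 < N)%N.
Hypothesis p2 : 2 < p.
Hypothesis s0 : 0 < s.
Hypothesis ker_int : forall eps (x : 'rV[R]_N), 0 < eps ->
  lam.-integrable setT (EFin \o cutker p s eps x).
Hypothesis meas_u : measurable_fun setT u.
Hypothesis uM : forall y, `|u y| <= M.

Variables (e : 'rV[R]_N) (mu : R).
Hypothesis e1 : dot e e = 1.
Local Notation T := (refl e mu).

Variables (x : 'rV[R]_N) (K : set 'rV[R]_N) (kappa d0 : R).
Hypothesis xmu : dot x e < mu.
Hypothesis Ux : u (T x) <= u x.
Hypothesis Umin : forall y, dot y e < mu -> u (T x) - u x <= u (T y) - u y.
Hypothesis mK : measurable K.
Hypothesis Kfin : (lam K < +oo)%E.
Hypothesis Kmu : forall y, K y -> dot y e < mu.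
Hypothesis d0_gt0 : 0 < d0.
Hypothesis Kx : forall y, K y -> d0 < enorm (x - y).
Hypothesis Kgap : forall y, K y -> kappa <=
  (spow p (u x - u y) - spow p (u (T x) - u (T y))) *
  ((enorm (x - y) `^ alpha)^-1 - (enorm (x - T y) `^ alpha)^-1).

Let alpha0 : 0 <= alpha.
Proof. by rewrite addr_ge0// mulr_ge0// ltW// (lt_trans _ p2). Qed.

(* bounds the contribution of the mirror image of the cut-out ball *)
Let err := 2 * spow p (2 * M) * ((mu - dot x e) `^ alpha)^-1.

Let spow2M w0 w1 : `|w0| <= M -> `|w1| <= M -> `|spow p (w0 - w1)| <= spow p (2 * M).
Proof.
move=> h0 h1; apply: spow_bound => //.
by rewrite (le_trans (ler_normB _ _))// mulr_natl lerD.
Qed.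

Let err_ge0 : 0 <= err.
Proof.
apply: mulr_ge0; last by rewrite invr_ge0 powR_ge0.
by rewrite mulr_ge0// (le_trans _ (spow2M (uM 0) (uM 0))).
Qed.

(* The difference of the two truncated integrands, plus the gain on K, minus an
   error on the cut-out ball. The error is needed because the truncation removes
   the ball around x but not its mirror image. *)
Let W eps y := plap_cut p s (u (T x)) (u \o T) x eps y -
  plap_cut p s (u x) u x eps y + kappa * \1_K y -
  err * \1_[set y | enorm (x - y) <= eps] y.

Let W_below eps y : 0 < eps -> eps < mu - dot x e -> eps < d0 ->
  dot y e < mu -> W eps y + W eps (T y) <= 0.
Proof.
move=> eps0 epsx epsd ymu.
have Tfar : mu - dot x e <= enorm (x - T y) by apply: enorm_sub_refl_ge => //; exact: ltW.
have near_le_far : enorm (x - y) <= enorm (x - T y).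
  by apply: enorm_sub_refl_le => //; exact: ltW.
have TyK : \1_K (T y) = 0 :> R.
  rewrite indicE memNset// => /Kmu; rewrite dot_refl//; apply/negP; rewrite -leNgt.
  by move: ymu; move: (dot y e) => z ymu; lra.
have epsT : eps < enorm (x - T y) by exact: lt_le_trans Tfar.
have TyB : \1_[set y | enorm (x - y) <= eps] (T y) = 0 :> R.
  by rewrite indicE memNset//=; apply/negP; rewrite -ltNge.
have -> : W eps (T y) = (spow p (u (T x) - u y) - spow p (u x - u (T y))) *
    (enorm (x - T y) `^ alpha)^-1.
  rewrite /W TyK TyB !mulr0 addr0 subr0 /plap_cut/= reflK// cutkerE//.
  by rewrite mulrBl.
have k'0 : 0 <= (enorm (x - T y) `^ alpha)^-1 by rewrite invr_ge0 powR_ge0.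
rewrite /W /plap_cut /=.
have a12 : spow p (u (T x) - u (T y)) <= spow p (u x - u y).
  by apply: spow_le => //; have := Umin ymu; move=> ?; lra.
have a1b2 : spow p (u (T x) - u (T y)) <= spow p (u x - u (T y)).
  by apply: spow_le => //; rewrite lerD2r.
have b1a2 : spow p (u (T x) - u y) <= spow p (u x - u y).
  by apply: spow_le => //; rewrite lerD2r.
have [yfar|ynear] := ltP eps (enorm (x - y)).
  rewrite cutkerE// [X in err * X]indicE memNset//=; last first.
    by apply/negP; rewrite -ltNge.
  have kk' : (enorm (x - T y) `^ alpha)^-1 <= (enorm (x - y) `^ alpha)^-1.
    by apply: ker_le => //; exact: lt_trans yfar.
  have gapK : kappa * \1_K y <=
      (spow p (u x - u y) - spow p (u (T x) - u (T y))) *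
      ((enorm (x - y) `^ alpha)^-1 - (enorm (x - T y) `^ alpha)^-1).
    rewrite indicE; have [yK|_] := boolP (y \in K).
      by rewrite mulr1 Kgap//; exact: set_mem.
    by rewrite mulr0 mulr_ge0// subr_ge0.
  rewrite mulr0 subr0; exact: folded_sum_le0.
rewrite cutker0// [X in kappa * X]indicE memNset; last first.
  by move=> /Kx; rewrite ltNge (le_trans ynear)// ltW.
rewrite indicE mem_set//= !mulr0 subr0 addr0 mulr1 add0r addrC subr_le0.
apply: (@le_trans _ _ (2 * spow p (2 * M) * (enorm (x - T y) `^ alpha)^-1)).
  apply: ler_wpM2r => //.
  have := spow2M (uM (T x)) (uM y); have := spow2M (uM x) (uM (T y)).
  rewrite !ler_norml; move: (spow p _) (spow p _) (spow p _) => ? ? ? /andP[? ?] /andP[? ?].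
  lra.
apply: ler_wpM2l; last by apply: ker_le => //; rewrite subr_gt0.
by rewrite mulr_ge0// (le_trans _ (spow2M (uM 0) (uM 0))).
Qed.

Let W_sym eps y : 0 < eps -> eps < mu - dot x e -> eps < d0 ->
  W eps y + W eps (T y) <= 0.
Proof.
move=> eps0 epsx epsd; have [ymu|muy|ymu] := ltgtP (dot y e) mu.
- exact: W_below.
- rewrite addrC -{2}(reflK mu e1 y); apply: W_below => //.
  by rewrite dot_refl//; move: muy; move: (dot y e) => z ymu; lra.
have Ty : T y = y by rewrite refl_fix.
have yfar : eps < enorm (x - y).
  by rewrite (lt_le_trans epsx)// -{1}Ty; apply: enorm_sub_refl_ge => //; rewrite ymu.
suff W0 : W eps y <= 0 by rewrite Ty; lra.
rewrite /W /plap_cut/= Ty cutkerE// !indicE !memNset ?mulr0 ?subr0 ?addr0//=.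
- rewrite -mulrBl mulr_le0_ge0 ?invr_ge0 ?powR_ge0// subr_le0.
  by apply: spow_le => //; rewrite lerD2r.
- by apply/negP; rewrite -ltNge.
- by move=> /Kmu; rewrite ymu ltxx.
Qed.

Let lamB eps : 0 < eps ->
  (lam [set y | (enorm (x - y) <= eps)%R] <= ((eps *+ 2) ^+ N)%:E)%E.
Proof. exact: lebesgue_rV_eball_le. Qed.

Let integrable_indic_lt (A : set 'rV[R]_N) (c : R) : measurable A ->
  (lam A < +oo)%E -> lam.-integrable setT (EFin \o (fun y => c * \1_A y)).
Proof.
move=> mA Afin.
have iA : lam.-integrable setT (EFin \o (\1_A : _ -> R)).
  apply/integrableP; split; first exact/measurable_EFinP/measurable_indic.
  rewrite (eq_integral (EFin \o (\1_A : _ -> R))) => [|y _]; last first.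
    by rewrite /= ger0_norm// indicE.
  by rewrite integral_indic// setIT.
exact: (integrableZl measurableT c iA).
Qed.

Let Rintegral_indic (A : set 'rV[R]_N) (c : R) : measurable A ->
  (lam A < +oo)%E -> \int[lam]_y (c * \1_A y) = c * fine (lam A).
Proof.
move=> mA Afin; rewrite RintegralZl//; last first.
  have := integrable_indic_lt 1 mA Afin.
  by apply: eq_integrable => // y _ /=; rewrite mul1r.
by rewrite /Rintegral integral_indic// setIT.
Qed.

Let trunc_le eps : 0 < eps -> eps < mu - dot x e -> eps < d0 ->
  fine (frac_plap_trunc p s u (T x) eps) - fine (frac_plap_trunc p s u x eps)
  <= - (kappa * fine (lam K)) + err * (eps *+ 2) ^+ N.
Proof.
move=> eps0 epsx epsd.
have i1 : lam.-integrable setT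
    (EFin \o plap_cut p s (u (T x)) (u \o T) x eps).
  apply: (integrable_plap_cut (M := M)) => //.
    exact: measurableT_comp (measurable_refl _ _).
  by move=> y; exact: uM.
have i2 : lam.-integrable setT (EFin \o plap_cut p s (u x) u x eps).
  exact: (integrable_plap_cut (M := M)).
have mB : measurable [set y | enorm (x - y) <= eps] by exact: measurable_eball.
have Bfin : (lam [set y | (enorm (x - y) <= eps)%R] < +oo)%E.
  by rewrite (le_lt_trans (lamB eps0))// ltry.
have iK := integrable_indic_lt kappa mK Kfin.
have iB := integrable_indic_lt err mB Bfin.
have i12 := integrableB measurableT i1 i2.
have i12K := integrableD measurableT i12 iK.
have iW : lam.-integrable setT (EFin \o W eps).
  exact: (integrableB measurableT i12K iB).
have := integral_sym_le0 e1 iW (fun y => W_sym y eps0 epsx epsd).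
rewrite /W RintegralB// RintegralD// RintegralB// !Rintegral_indic//.
rewrite (frac_plap_trunc_refl p2 ker_int meas_u uM)// frac_plap_truncE.
rewrite -!/(Rintegral _ _ _).
have : fine (lam [set y | (enorm (x - y) <= eps)%R]) <= (eps *+ 2) ^+ N.
  rewrite -lee_fin fineK; first exact: lamB.
  by rewrite ge0_fin_numE.
move=> /(ler_wpM2l err_ge0); move: (err * _) (err * _) (kappa * _) => ? ? ?.
move: (\int[_]_(_ in _) _) (\int[_]_(_ in _) _) => ? ?; lra.
Qed.

(** The integral of W is nonpositive by folding, and the error carried by W is
    at most err times the volume of the cut-out ball, which tends to 0 with eps;
    only the gain on K remains in the limit. *)
Lemma frac_plap_refl_le I1 I2 :
  frac_plap_trunc p s u (T x) eps @[eps --> 0^'+] --> I1%:E ->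
  frac_plap_trunc p s u x eps @[eps --> 0^'+] --> I2%:E ->
  I1 - I2 <= - (kappa * fine (lam K)).
Proof.
move=> /fine_cvg c1 /fine_cvg c2.
have -> : - (kappa * fine (lam K)) = - (kappa * fine (lam K)) + err * 0.
  by rewrite mulr0 addr0.
apply: (ler_cvg_to (cvgB c1 c2) (g := fun eps =>
    - (kappa * fine (lam K)) + err * (eps *+ 2))).
  apply: cvgD; first exact: cvg_cst.
  have c3 : (fun eps : R => eps *+ 2) @ 0^'+ --> (0 *+ 2 : R).
    by apply: cvgMn; apply: cvg_at_right_filter; exact: cvg_id.
  by rewrite mul0rn in c3; apply: cvgMl_tmp.
near=> eps.
have eps0 : 0 < eps by near: eps; exact: nbhs_right_gt.
apply: (le_trans (trunc_le eps0 _ _)) => /=.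
- by near: eps; apply: nbhs_right_lt; rewrite subr_gt0.
- by near: eps; exact: nbhs_right_lt.
(* for 2 * eps <= 1 the bound (2 * eps) ^+ N may be replaced by 2 * eps *)
rewrite lerD2l ler_wpM2l//.
have : eps < 2^-1 by near: eps; apply: nbhs_right_lt; rewrite invr_gt0.
rewrite -(prednK N0) exprS => h; rewrite ger_pMr; last by rewrite mulrn_wgt0.
by apply: exprn_ile1; rewrite -mulr_natr; lra.
Unshelve. all: by end_near. Qed.

End comparison.

(** * Integrability of the truncated kernel *)

Section kernel_integrability.
Context {R : realType} {N : nat}.
Local Notation lam := (lebesgue_rV N).
Implicit Types (x y e : 'rV[R]_N) (w : 'rV[R]_N -> R).

Lemma measurable_enormB_powR x (b : R) :
  measurable_fun [set: 'rV[R]_N] (fun y => enorm (x - y) `^ b).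
Proof.
apply: (@measurableT_comp _ _ _ _ _ _ (@powR R ^~ b)) => //.
exact: measurable_enormB.
Qed.

(** The numerator in the definition of the space is at least 1 because w is
    positive; so membership already makes the weight integrable, and no
    computation in polar coordinates is needed. *)
Lemma Lsp_kernel_integrable (p s : R) w : 2 < p -> 
  (forall y, 0 < w y) -> Lsp_space p s w ->
  lam.-integrable setT
    (EFin \o (fun y : 'rV[R]_N => (1 + enorm y `^ (N%:R + s * p))^-1)).
Proof.
move=> p2 w0 [[mw _] wfin].
set alpha := N%:R + s * p.
have den0 y : 0 < 1 + enorm y `^ alpha by rewrite ltr_pwDl// powR_ge0.
have mker : measurable_fun setT (fun y : 'rV[R]_N => (1 + enorm y `^ alpha)^-1).
  under eq_fun do rewrite -powR_inv1 ?ltW//.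
  apply: (@measurableT_comp _ _ _ _ _ _ (@powR R ^~ (-1))) => //.
  apply: measurable_funD => //.
  by under eq_fun do rewrite -enormN -sub0r; exact: measurable_enormB_powR.
apply/integrableP; split; first exact/measurable_EFinP.
apply: le_lt_trans wfin; apply: ge0_le_integral => //.
- by apply/measurable_EFinP; exact: measurableT_comp.
- apply/measurable_EFinP; apply: measurable_funM => //.
  apply: (@measurableT_comp _ _ _ _ _ _ (@powR R ^~ (p - 1))) => //.
  by apply: measurableT_comp => //; exact: measurable_funD.
move=> y _ /=; have inv0 : 0 <= (1 + enorm y `^ alpha)^-1 by rewrite invr_ge0 ltW.
rewrite lee_fin ger0_norm// -[leLHS]mul1r ler_wpM2r//.
have wy := w0 y; rewrite ger0_norm; last by lra.
apply: (@le_trans _ _ (1 `^ (p - 1))); first by rewrite powR1.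
by rewrite ge0_ler_powR ?nnegrE//; lra.
Qed.

(** Away from x the kernel is dominated by a multiple of the integrable weight:
    1 is at most (enorm (x - y) / eps) `^ alpha and enorm y is at most
    B * enorm (x - y). *)
Lemma cutker_integrable (p s : R) w : 2 < p -> 0 < s ->
  (forall y, 0 < w y) -> Lsp_space p s w -> forall eps x, 0 < eps ->
  lam.-integrable setT (EFin \o cutker p s eps x).
Proof.
move=> p2 s0 w0 wL eps x eps0; set alpha := N%:R + s * p.
have alpha0 : 0 < alpha by rewrite ltr_wpDl// mulr_gt0//; lra.
pose B := Num.sqrt (2 * dot x x / eps ^+ 2 + 2).
pose c := eps `^ (- alpha) + B `^ alpha.
have ik := integrableZl measurableT c (Lsp_kernel_integrable p2 w0 wL).
apply: le_integrable ik => //.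
  apply/measurable_EFinP; apply: measurable_fun_ifT => //.
    by apply: measurable_fun_ltr => //; exact: measurable_enormB.
  by under eq_fun do rewrite -powRN; exact: measurable_enormB_powR.
move=> y _ /=; rewrite lee_fin ger0_norm ?cutker_ge0//.
have den0 : 0 < 1 + enorm y `^ alpha by rewrite ltr_pwDl// powR_ge0.
have c0 : 0 <= c by rewrite addr_ge0// powR_ge0.
rewrite ger0_norm; last by rewrite mulr_ge0 ?invr_ge0// ltW.
rewrite /cutker -/alpha; case: ifPn => [far|_]; last first.
  by rewrite mulr_ge0 ?invr_ge0// ltW.
have d0 : 0 < enorm (x - y) by exact: lt_trans far.
have da0 : 0 < enorm (x - y) `^ alpha by rewrite powR_gt0.
rewrite ler_pdivlMr// ler_pdivrMl// mulrDr lerD//.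
  rewrite powRN ler_pdivlMr ?powR_gt0// mul1r.
  by rewrite ge0_ler_powR ?nnegrE// ltW.
rewrite -powRM ?sqrtr_ge0 ?enorm_ge0// ge0_ler_powR ?nnegrE ?enorm_ge0//.
- exact: ltW.
- by rewrite mulr_ge0// ?sqrtr_ge0 ?enorm_ge0.
rewrite -ler_sqr ?nnegrE ?enorm_ge0//; last by rewrite mulr_ge0// ?sqrtr_ge0 ?enorm_ge0.
have B20 : 0 <= 2 * dot x x / eps ^+ 2 + 2.
  by rewrite addr_ge0// mulr_ge0 ?invr_ge0 ?sqr_ge0// mulr_ge0// dot_ge0.
rewrite exprMn [B ^+ 2]sqr_sqrtr// mulrDr enorm_sqr.
have : dot y y <= 2 * dot (x - y) (x - y) + 2 * dot x x.
  have -> : dot y y = dot (- (x - y) + x) (- (x - y) + x).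
    by rewrite opprB subrK.
  by apply: (le_trans (dot_addr_le _ _)); rewrite dotNl dotNr opprK.
move=> /le_trans; apply; rewrite -(enorm_sqr (x - y)) [leLHS]addrC [2 * _ ^+ 2]mulrC lerD2r.
rewrite mulrCA -[leLHS]mulr1 ler_wpM2l ?mulr_ge0 ?dot_ge0//.
rewrite ler_pdivlMr ?exprn_gt0// mul1r ler_sqr ?nnegrE ?enorm_ge0//; exact: ltW.
Qed.
End kernel_integrability.

(** * Decay, compactness and attained minima *)

Section continuity.
Context {R : realType} {N : nat}.
Implicit Types (x y e : 'rV[R]_N) (w : 'rV[R]_N -> R).

Section filter.
Context {I : Type} {F : set_system I} {FF : Filter F}.

Lemma cvg_dot (f g : I -> 'rV[R]_N) x y :
  f @ F --> x -> g @ F --> y -> dot (f t) (g t) @[t --> F] --> dot x y.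
Proof.
move=> fx gy; apply: (cvg_big (op := +%R)) => [|i _]; first exact: add_continuous.
by apply: cvgM; [exact: (continuous_cvg _ (@coord_continuous _ _ _ _ _ x) fx) |
  exact: (continuous_cvg _ (@coord_continuous _ _ _ _ _ y) gy)].
Qed.

Lemma cvg_enorm (f : I -> 'rV[R]_N) x :
  f @ F --> x -> enorm (f t) @[t --> F] --> enorm x.
Proof.
by move=> fx; exact: (continuous_cvg _ (@sqrt_continuous _ _) (cvg_dot fx fx)).
Qed.

Lemma cvg_hrefl e (f : I -> 'rV[R]_N) (g : I -> R) x mu :
  f @ F --> x -> g @ F --> mu -> refl e (g t) (f t) @[t --> F] --> refl e mu x.
Proof.
move=> fx gmu; apply: cvgD; first exact: fx.
apply: cvgZ; last exact: cvg_cst.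
apply: cvgM; first exact: cvg_cst.
apply: cvgB; first exact: gmu.
by apply: cvg_dot => //; exact: cvg_cst.
Qed.

Lemma cvg_refl_diff w e (f : I -> 'rV[R]_N) (g : I -> R) x mu : continuous w ->
  f @ F --> x -> g @ F --> mu ->
  w (refl e (g t) (f t)) - w (f t) @[t --> F] --> w (refl e mu x) - w x.
Proof.
move=> cw fx gmu; apply: cvgB; last exact: (continuous_cvg _ (cw x) fx).
exact: (continuous_cvg _ (cw _) (cvg_hrefl fx gmu)).
Qed.

End filter.

Definition vanishing w := forall eps, 0 < eps ->
  exists rho, forall x, rho < enorm x -> w x < eps.

Lemma decays_like_vanishing w k : 0 < k -> decays_like w k -> vanishing w.
Proof.
move=> k0 [c [C [rho [c0 cC H]]]] eps eps0.
have C0 : 0 < C by exact: lt_le_trans cC.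
exists (Num.max rho ((C / eps) `^ k^-1)) => x.
rewrite gt_max => /andP[rx Cx]; have /andP[_ /le_lt_trans] := H _ rx; apply.
have x0 : 0 < enorm x by rewrite (le_lt_trans _ Cx)// powR_ge0.
rewrite powRN ltr_pdivrMr ?powR_gt0// mulrC -ltr_pdivrMr//.
have -> : C / eps = ((C / eps) `^ k^-1) `^ k.
  by rewrite -powRrM mulVf ?gt_eqF// powRr1// divr_ge0// ltW.
by apply: gt0_ltr_powR; rewrite ?nnegrE ?powR_ge0// ltW.
Qed.

Definition box (rho : R) := [set x : 'rV[R]_N | forall i, x ord0 i \in `[- rho, rho]].

Lemma compact_box rho : compact (box rho).
Proof.
exact: (@rV_compact _ _ (fun=> `[- rho, rho]%classic) (fun=> @segment_compact _ _ _)).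
Qed.

Lemma not_box rho x : ~ box rho x -> rho < enorm x.
Proof.
apply: contra_notP => /negP; rewrite -leNgt => xrho i.
have := le_trans (coord_le_enorm x i) xrho.
by rewrite ler_norml in_itv.
Qed.

Lemma vanishing_bounded w : continuous w -> (forall x, 0 < w x) ->
  vanishing w -> exists M, forall x, `|w x| <= M.
Proof.
move=> cw w0 /(_ _ ltr01)[rho wrho].
have [|c _ cmax] := EVT_max_rV (f := w) (A := box `|rho|) _ (@compact_box _)
    (continuous_subspaceT cw).
  by exists 0 => i; rewrite mxE in_itv/= oppr_le0 normr_ge0.
exists (Num.max 1 (w c)) => x; rewrite gtr0_norm// le_max.
have [xb|/not_box xb] := pselect (box `|rho| x).
  by rewrite cmax ?orbT// inE.
by rewrite ltW// wrho// (le_lt_trans (ler_norm _)).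
Qed.

Lemma continuous_dotl e : continuous (fun x : 'rV[R]_N => dot x e).
Proof.
move=> x; have H := @cvg_dot _ _ (nbhs_filter x) id (cst e) x e cvg_id (cvg_cst e).
exact: H.
Qed.

Lemma closed_halfspace e mu : closed [set x | dot x e <= mu].
Proof.
by have /continuous_closedP/(_ _ (@closed_le R mu)) := @continuous_dotl e.
Qed.

Lemma continuous_refl_diff w e mu : continuous w ->
  continuous (fun x => w (refl e mu x) - w x).
Proof.
move=> cw x; have H := @cvg_refl_diff _ _ (nbhs_filter x) w e id (cst mu) x mu
  cw cvg_id (cvg_cst mu).
exact: H.
Qed.

(** Where w is small the difference w (x^mu) - w x exceeds - w x, so a negative
    value forces the minimum into a compact piece of the closed half-space; it
    avoids the hyperplane, where the difference is 0. *)
Lemma negative_min_attained w e mu y0 : dot e e = 1 -> continuous w ->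
  (forall x, 0 < w x) -> vanishing w ->
  dot y0 e < mu -> w (refl e mu y0) - w y0 < 0 ->
  exists x, [/\ dot x e < mu, w (refl e mu x) - w x < 0 &
    forall y, dot y e < mu -> w (refl e mu x) - w x <= w (refl e mu y) - w y].
Proof.
move=> e1 cw w0 vw y0mu Uy0.
pose U x := w (refl e mu x) - w x.
have [rho wrho] := vw (- U y0) ltac:(by rewrite oppr_gt0).
pose A := box rho `&` [set x | dot x e <= mu].
have out y : ~ box rho y -> U y0 < U y.
  move=> /not_box/wrho; rewrite /U; have := w0 (refl e mu y); lra.
have in0 : A y0.
  split; last exact: ltW.
  by apply: contrapT => /out; rewrite ltxx.
have cU : continuous U.
  exact: continuous_refl_diff.
have cA : compact A by apply: compact_closedI; [exact: compact_box | exact: closed_halfspace].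
have [|c cA' cmin] := EVT_min_rV (f := U) (A := A) _ cA (continuous_subspaceT cU).
  by exists y0.
have Uc : U c <= U y0 by apply: cmin; rewrite inE.
move: cA'; rewrite inE => -[cb]; rewrite /= le_eqVlt => /predU1P[ce|cmu].
  by move: Uc; rewrite {1}/U refl_fix// subrr leNgt Uy0.
exists c; split => //; first exact: le_lt_trans Uc Uy0.
move=> y ymu; have [yb|/out/ltW] := pselect (box rho y).
  by apply: cmin; rewrite inE; split => //; exact: ltW.
exact: le_trans.
Qed.

End continuity.

(** * Consequences for solutions of the equation *)

Section equation.
Context {R : realType} {N : nat}.
Local Notation lam := (lebesgue_rV N).
Variables (p s C M : R) (u v : 'rV[R]_N -> R) (F : R -> R -> R).
Local Notation alpha := (N%:R + s * p).
Hypothesis N2 : (2 <= N)%N.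
Hypothesis p2 : 2 < p.
Hypothesis s0 : 0 < s.
Hypothesis C0 : 0 < C.
Hypothesis ker_int : forall eps (x : 'rV[R]_N), 0 < eps ->
  lam.-integrable setT (EFin \o cutker p s eps x).
Hypothesis meas_u : measurable_fun setT u.
Hypothesis uM : forall y, `|u y| <= M.
Hypothesis cu : continuous u.
Hypothesis equ : forall x, exists2 I,
  frac_plap_trunc p s u x eps @[eps --> 0^'+] --> I%:E & C * I = F (u x) (v x).

Lemma pde_diff_le e mu x K kappa d0 : dot e e = 1 ->
  dot x e < mu -> u (refl e mu x) <= u x ->
  (forall y, dot y e < mu ->
     u (refl e mu x) - u x <= u (refl e mu y) - u y) ->
  measurable K -> (lam K < +oo)%E -> (forall y, K y -> dot y e < mu) ->
  0 < d0 -> (forall y, K y -> d0 < enorm (x - y)) ->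
  (forall y, K y -> kappa <=
    (spow p (u x - u y) - spow p (u (refl e mu x) - u (refl e mu y))) *
    ((enorm (x - y) `^ alpha)^-1 - (enorm (x - refl e mu y) `^ alpha)^-1)) ->
  F (u (refl e mu x)) (v (refl e mu x)) - F (u x) (v x) <=
    - (C * (kappa * fine (lam K))).
Proof.
move=> e1 xmu Ux Umin mK Kfin Kmu d0_gt0 Kx Kgap.
have [I1 c1 <-] := equ (refl e mu x); have [I2 c2 <-] := equ x.
rewrite -mulrBr -mulrN ler_pM2l//.
exact: (frac_plap_refl_le (ltnW N2) p2 s0 ker_int meas_u uM e1 xmu Ux Umin mK
  Kfin Kmu d0_gt0 Kx Kgap c1 c2).
Qed.

Lemma pde_le e mu x : dot e e = 1 -> dot x e < mu -> u (refl e mu x) <= u x ->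
  (forall y, dot y e < mu ->
     u (refl e mu x) - u x <= u (refl e mu y) - u y) ->
  F (u (refl e mu x)) (v (refl e mu x)) <= F (u x) (v x).
Proof.
move=> e1 xmu Ux Umin; rewrite -subr_le0.
have := @pde_diff_le e mu x set0 0 1 e1 xmu Ux Umin.
rewrite measure0 mul0r mulr0 oppr0; apply => //; exact: ltr01.
Qed.

(** Take for K a small cube around y0. For x near xbar and mu near lam0, the
    reflected difference of u exceeds a positive constant on K, so the gap of
    the odd power is bounded below there, and the gap of the kernel is bounded
    below by a multiple of mu - x . e. The strong maximum principle uses this at
    (xbar, lam0) itself, the estimate near the hyperplane uses it with xbar on
    the hyperplane. *)
Lemma pde_near e lam0 xbar y0 : dot e e = 1 -> dot y0 e < lam0 ->
  u (refl e lam0 xbar) <= u xbar -> u y0 < u (refl e lam0 y0) ->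
  exists2 kappa0 : R, 0 < kappa0 & \forall x \near xbar & mu \near lam0,
    dot x e < mu -> u (refl e mu x) <= u x ->
    (forall y, dot y e < mu ->
       u (refl e mu x) - u x <= u (refl e mu y) - u y) ->
    F (u (refl e mu x)) (v (refl e mu x)) - F (u x) (v x) <=
    - (kappa0 * (mu - dot x e)).
Proof.
move=> e1 y0l Ux Uy0.
pose eta := (lam0 - dot y0 e) / 2; have eta0 : 0 < eta by rewrite divr_gt0// subr_gt0.
pose c := (u (refl e lam0 y0) - u y0) / 2.
have c0 : 0 < c by rewrite divr_gt0// subr_gt0.
have xy0 : 0 < enorm (xbar - y0).
  by rewrite enorm_gt0 subr_eq0; apply: contraTneq Ux => ->; rewrite -ltNge.
pose d0 := enorm (xbar - y0) / 2; have d00 : 0 < d0 by rewrite divr_gt0.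
pose L := enorm (xbar - refl e lam0 y0) + 1.
have L0 : 0 < L by rewrite ltr_wpDl ?enorm_ge0.
have [[A B] /= [nA nB] AB] : \forall z \near (y0, (xbar, lam0)),
    [/\ eta < z.2.2 - dot z.1 e, c < u (refl e z.2.2 z.1) - u z.1,
        d0 < enorm (z.2.1 - z.1) & enorm (z.2.1 - refl e z.2.2 z.1) < L].
  pose P := ('rV[R]_N * ('rV[R]_N * R))%type.
  have cy : (fun z : P => z.1) @ (y0, (xbar, lam0)) --> y0 by exact: cvg_fst.
  have cx : (fun z : P => z.2.1) @ (y0, (xbar, lam0)) --> xbar.
    exact: (cvg_comp _ _ cvg_snd cvg_fst).
  have cm : (fun z : P => z.2.2) @ (y0, (xbar, lam0)) --> lam0.
    exact: (cvg_comp _ _ cvg_snd cvg_snd).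
  near=> z; split; near: z.
  - apply: (cvgr_gt _ (cvgB cm (cvg_dot cy (cvg_cst e)))).
    by rewrite /eta; lra.
  - apply: (cvgr_gt _ (cvg_refl_diff (e := e) cu cy cm)).
    by rewrite /c; lra.
  - apply: (cvgr_gt _ (cvg_enorm (cvgB cx cy))).
    by rewrite /d0; lra.
  - apply: (cvgr_lt _ (cvg_enorm (cvgB cx (cvg_hrefl (e := e) cy cm)))).
    by rewrite /L; lra.
have /nbhs_ballP[r /= r0 rA] := nA.
pose h := r / 2; have h0 : 0 < h by rewrite divr_gt0.
have hr : h < r by rewrite ltr_pdivrMr// ltr_pMr// ltr1n.
pose K := [set y : 'rV[R]_N | forall i, y ord0 i \in `[y0 ord0 i - h, y0 ord0 i + h]].
have KA y : K y -> A y.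
  move=> yK; apply: rA; split=> // i j.
  have := yK j; rewrite (ord1 i : i = ord0) in_itv/= /ball/= => /andP[? ?].
  by rewrite (@le_lt_trans _ _ h)// ler_norml; lra.
have mK : measurable K by exact: measurable_cube.
have lamK : lam K = ((h *+ 2) ^+ N)%:E by exact: lebesgue_rV_cube.
have gap0 : 0 < (c / 2) `^ (p - 2) * (c / 2).
  have c2 : 0 < c / 2 by rewrite divr_gt0.
  by rewrite mulr_gt0// powR_gt0.
have La0 : 0 < L ^+ 2 * L `^ alpha by rewrite mulr_gt0 ?exprn_gt0 ?powR_gt0//.
pose k1 := (c / 2) `^ (p - 2) * (c / 2) * (4 * eta / (L ^+ 2 * L `^ alpha)).
have k10 : 0 < k1 by rewrite mulr_gt0// divr_gt0// mulr_gt0.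
exists (C * (k1 * (h *+ 2) ^+ N)).
  by rewrite mulr_gt0// mulr_gt0// exprn_gt0// mulrn_wgt0.
apply: filterS nB => -[x mu] /= xB xmu Uxmu Umin.
have KB y : K y -> _ := fun yK => AB (y, (x, mu)) (conj (KA y yK) xB).
have dx0 : 0 < mu - dot x e by rewrite subr_gt0.
have -> : C * (k1 * (h *+ 2) ^+ N) * (mu - dot x e) =
    C * ((k1 * (mu - dot x e)) * fine (lam K)) by rewrite lamK/=; ring.
apply: (pde_diff_le (d0 := d0)) => //.
- by rewrite lamK ltry.
- by move=> y /KB[/= h1 _ _ _]; rewrite -subr_gt0 (lt_trans eta0).
- by move=> y /KB[].
move=> y /KB[/= h1 h2 h3 h4].
have ymu : dot y e < mu by rewrite -subr_gt0 (lt_trans eta0).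
have dle : enorm (x - y) <= enorm (x - refl e mu y).
  by apply: enorm_sub_refl_le => //; exact: ltW.
have a2 : 2 <= alpha.
  by rewrite -[leLHS]addr0 lerD ?ler_nat// mulr_ge0// ltW// (lt_trans _ p2).
have kg := ker_gap a2 (lt_trans d00 h3) dle (ltW h4).
rewrite /k1 -mulrA; apply: ler_pM.
- exact: ltW.
- by rewrite mulr_ge0// ltW// divr_gt0// mulr_gt0.
- apply: spow_gap => //; first exact: ltW.
  by rewrite -addrA lerD// addrC lerBlDr addrC ltW.
apply: le_trans kg; rewrite mulrAC ler_wpM2r//; first by rewrite invr_ge0 ltW.
rewrite !enorm_sqr dot_sub_refl// [leRHS]addrC addKr [leRHS]mulrAC ler_wpM2r//; first exact: ltW.
by rewrite ler_wpM2l// ltW.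
Unshelve. all: by end_near. Qed.

End equation.

(** * First order behaviour at the hyperplane *)

Section slope.
Context {R : realType} {N : nat}.
Implicit Types (x y e : 'rV[R]_N) (w : 'rV[R]_N -> R).

Lemma C11_continuous_grad w : C11_loc w -> continuous (grad w).
Proof.
move=> [_ lipw] x.
have [M [_ HM]] := lipw _ (@compact_box R N (enorm x + 1)).
pose k := Num.max M 0 + 1; have k0 : 0 < k by rewrite ltr_wpDl// le_max lexx orbT.
have Mk : M < k by rewrite ltr_pwDr// le_max lexx.
have xbox : box (enorm x + 1) x.
  move=> i; have := coord_le_enorm x i.
  by rewrite ler_norml in_itv/= => /andP[? ?]; lra.
apply/(@cvgrPdist_lt _ _ _ _ (nbhs_filter (x : 'rV[R]_N))) => eps eps0.
apply/nbhs_ballP.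
exists (Num.min 1 (eps / k)); first by rewrite /= lt_min ltr01 divr_gt0.
move=> y xy; have ybox : box (enorm x + 1) y.
  move=> i; have := coord_le_enorm x i; have [_ /(_ ord0 i)] := xy.
  rewrite /ball/= lt_min ltr_norml ler_norml in_itv/= => /andP[/andP[? ?] _] /andP[? ?].
  by apply/andP; split; lra.
have := HM _ Mk (x, y) (conj xbox ybox) => /= /le_lt_trans; apply.
rewrite mulrC -ltr_pdivlMr//.
by move: xy; rewrite mx_norm_ball /ball_/= lt_min => /andP[].
Qed.

Lemma derive_dot_grad w x e : differentiable w x -> 'D_e w x = dot e (grad w x).
Proof.
move=> dw; rewrite deriveE// [in LHS](row_sum_delta e) linear_sum.
apply: eq_bigr => i _; rewrite linearZ/= mxE deriveE//.
Qed.

Lemma MVT_line w x e t : (forall z, differentiable w z) -> 0 < t ->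
  exists2 th, 0 < th < t & w (x + t *: e) - w x = t * 'D_e w (x + th *: e).
Proof.
move=> dw t0; pose f (a : R) := w (x + a *: e).
have df a : is_derive a (1 : R) f ('D_e w (x + a *: e)).
  have E : (fun h : R => h^-1 *: ((f \o shift a) (h *: (1 : R)) - f a)) =
      (fun h : R => h^-1 *: ((w \o shift (x + a *: e)) (h *: e) - w (x + a *: e))).
    apply/funext => h /=; congr (_ *: (w _ - _)).
    have -> : h *: (1 : R) = h by exact: mulr1.
    by rewrite scalerDl addrCA.
  split; first by rewrite /derivable E; exact: diff_derivable.
  by rewrite /derive E.
have [|th] := MVT t0 (fun a _ => df a) _.
  apply: continuous_subspaceT => a.
  by apply: differentiable_continuous; apply/derivable1_diffP; exact: ex_derive.
rewrite in_itv/= subr0 /f scale0r addr0 => th0t.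
by move=> E; exists th; rewrite // mulrC.
Qed.

Lemma norm_coord_le e i : dot e e = 1 -> `|e ord0 i| <= 1.
Proof.
by move=> e1; have := coord_le_enorm e i; rewrite enormE e1 sqrtr1.
Qed.

(** By the mean value theorem w (x^mu) - w x is 2 * (mu - x . e) times the
    derivative of w along e at a point close to xbar. That derivative is
    continuous, and it is nonnegative at xbar: otherwise w would decrease along
    e near xbar, against the comparison of points symmetric about xbar. *)
Lemma slope_near w xbar e lam0 : C11_loc w -> dot e e = 1 -> dot xbar e = lam0 ->
  (forall x, dot x e < lam0 -> w x <= w (refl e lam0 x)) ->
  forall eps, 0 < eps -> \forall x \near xbar & mu \near lam0,
    dot x e < mu -> - (eps * (mu - dot x e)) <= w (refl e mu x) - w x.
Proof.
move=> w11 e1 xl wl eps eps0; have [dw _] := w11.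
pose g x := 'D_e w x.
have cg : continuous g.
  rewrite (_ : g = fun x => dot (grad w x) e); last first.
    by apply/funext => x; rewrite /g derive_dot_grad// dotC.
  move=> x; have H := @cvg_dot _ _ _ _ (nbhs_filter x) (grad w) (cst e) _ e
    (C11_continuous_grad w11 (x := x)) (cvg_cst e).
  exact: H.
have seg (P : set R) : (\forall z \near xbar, P (g z)) ->
    exists2 r : R, 0 < r & forall x t,
    (forall i, `|(x - xbar) ord0 i| < r) -> 0 < t -> t < r ->
    exists2 c, P c & w (x + t *: e) - w x = t * c.
  move=> /nbhs_ballP[r /= r0 rg].
  exists (r / 2) => [|x t xr t0 tr]; first by rewrite divr_gt0.
  have [th /andP[th0 tht] ->] := MVT_line x e dw t0.
  exists (g (x + th *: e)) => //; apply: rg; split=> // i j.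
  rewrite (ord1 i : i = ord0) /ball/=.
  have := xr j; have := norm_coord_le j e1; rewrite !mxE => ej xj.
  have -> : xbar ord0 j - (x ord0 j + th * e ord0 j) =
    - ((x ord0 j - xbar ord0 j) + th * e ord0 j) by ring.
  rewrite normrN; apply: (le_lt_trans (ler_normD _ _)).
  have h1 : `|th * e ord0 j| <= th by rewrite normrM gtr0_norm// ger_pMr.
  by rewrite (splitr r) ltrD// (le_lt_trans h1)// (lt_trans tht).
have g0 : 0 <= g xbar.
  rewrite leNgt; apply/negP => /(cvgr_lt _ (cg xbar))/(seg [set c | c < 0])[r r0 seg'].
  pose x := xbar - (r / 4) *: e.
  have xe : dot x e = lam0 - r / 4 by rewrite /x !dotE e1 xl; ring.
  have rE : refl e lam0 x = x + (r / 2) *: e.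
    by rewrite /refl xe; congr (_ + _ *: _); field.
  have [|||c /= c0 xc] := seg' x (r / 2).
  - move=> i; rewrite /x !mxE; have -> : xbar ord0 i - r / 4 * e ord0 i - xbar ord0 i =
      - (r / 4 * e ord0 i) by ring.
    rewrite normrN normrM gtr0_norm ?divr_gt0//.
    apply: (@le_lt_trans _ _ (r / 4)); last by rewrite ltr_pdivrMr// ltr_pMr// ltr1n.
    by rewrite ger_pMr ?divr_gt0// norm_coord_le.
  - by rewrite divr_gt0.
  - by rewrite ltr_pdivrMr// ltr_pMr// ltr1n.
  have : w x <= w (refl e lam0 x) by apply: wl; rewrite xe gtrBl divr_gt0.
  by rewrite -subr_ge0 rE xc leNgt pmulr_rlt0 ?c0// divr_gt0.
have geps : - (eps / 2) < g xbar by rewrite (lt_le_trans _ g0)// oppr_lt0 divr_gt0.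
have [r r0 seg'] := seg [set c | - (eps / 2) < c] (cvgr_gt _ (cg xbar) _ geps).
pose P := ('rV[R]_N * R)%type.
have cx : (fun z : P => z.1) @ (xbar, lam0) --> xbar by exact: cvg_fst.
have cm : (fun z : P => z.2) @ (xbar, lam0) --> lam0 by exact: cvg_snd.
have H1 := cx _ (nbhsx_ballx xbar r r0).
have H2 : \forall z \near (xbar, lam0), z.2 - dot z.1 e < r / 2.
  apply: (cvgr_lt _ (cvgB cm (cvg_dot cx (cvg_cst e)))).
  by rewrite xl subrr divr_gt0.
have H : \forall z \near (xbar, lam0), ball xbar r z.1 /\ z.2 - dot z.1 e < r / 2.
  by near=> z; split; near: z.
apply: filterS H => -[x mu] /= [xr mur] xmu.
have -> : - (eps * (mu - dot x e)) = 2 * (mu - dot x e) * - (eps / 2) by field.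
have d0 : 0 < 2 * (mu - dot x e) by rewrite mulr_gt0// subr_gt0.
have [||c /= /ltW c0 xc] := seg' x (2 * (mu - dot x e)) _ d0.
  by move=> i; have [_ /(_ ord0 i)] := xr; rewrite /ball/= distrC !mxE.
  by rewrite mulrC -ltr_pdivlMr.
by rewrite /refl xc ler_pM2l.
Unshelve. all: by end_near. Qed.

End slope.

(** * The right-hand side after absorbing the zero order term *)

Section nonlinearity.
Context {R : realType}.
Implicit Types (x y z : R).
Variables (p a m n : R) (f : R -> R -> R).
Hypothesis p2 : 2 < p.
Hypothesis a0 : 0 < a.
Hypothesis hf : C1_quadrant f.
Hypothesis fv : forall y z : R, 0 < y -> 0 < z -> 0 < partial2 f y z.
Hypothesis fsmall : \forall y \near 0^'+ & z \near 0^'+,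
  partial1 f y z <= y `^ (m - 1) * z `^ n /\
  partial2 f y z <= y `^ m * z `^ (n - 1).
Hypothesis fincr : exists2 e : R, 0 < e & forall z : R, 0 < z ->
  {in `]0, e[ &, {homo (fun y => partial1 f y z
     - a * (p - 1) * y `^ (p - 2)) : y1 y2 / y1 < y2}}.
Hypothesis hm : p - 1 <= m.
Hypothesis hn : 1 <= n.

Let p1 : 0 < p - 1.
Proof. by rewrite subr_gt0 (lt_trans _ p2)// ltr1n. Qed.

Let m1 : 1 <= m.
Proof. by apply: le_trans hm; rewrite lerBrDr ltW. Qed.

Definition source (y z : R) := f y z - a * y `^ (p - 1).

Let source1 (y z : R) := partial1 f y z - a * (p - 1) * y `^ (p - 2).

Lemma source_MVT1 (y' y z : R) : 0 < y' -> y' < y -> 0 < z ->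
  exists2 xi, y' < xi < y & source y z - source y' z = source1 xi z * (y - y').
Proof.
move=> y'0 y'y z0.
have dF x : 0 < x -> is_derive x (1 : R) (source^~ z) (source1 x z).
  move=> x0; have [fd _ _ _] := hf x0 z0.
  have xI : x \in `]0, +oo[ by rewrite in_itv/= andbT.
  have pd : derivable (fun y => y `^ (p - 1)) x 1 by exact: derivable_powR.
  have -> : source1 x z = 'D_1 (f ^~ z) x - a *: 'D_1 (fun y => y `^ (p - 1)) x.
    rewrite /source1 /partial1 derive1E; congr (_ - _).
    rewrite -[X in a *: X]derive1E powR_derive1// -mulrA; congr (_ * (_ * _ `^ _)).
    by ring.
  by apply: is_deriveB; [exact: DeriveDef | apply: is_deriveZ; exact: DeriveDef].
have [||xi] := MVT y'y (f := source^~ z) (df := source1^~ z) _ _.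
- by move=> x; rewrite in_itv/= => /andP[y'x _]; apply: dF; exact: lt_trans y'x.
- apply: derivable_within_continuous => x; rewrite in_itv/= => /andP[y'x _].
  by apply: ex_derive; apply: dF; exact: lt_le_trans y'x.
by rewrite in_itv/= => h ->; exists xi.
Qed.

Lemma source_MVT2 (y z' z : R) : 0 < y -> 0 < z' -> z' < z ->
  exists2 xi, z' < xi < z &
    source y z - source y z' = partial2 f y xi * (z - z').
Proof.
move=> y0 z'0 z'z.
have dF x : 0 < x -> is_derive x (1 : R) (f y) (partial2 f y x).
  move=> x0; have [_ fd _ _] := hf y0 x0.
  by apply: DeriveDef => //; rewrite /partial2 derive1E.
have [||xi] := MVT z'z (f := f y) (df := partial2 f y) _ _.
- by move=> x; rewrite in_itv/= => /andP[y'x _]; apply: dF; exact: lt_trans y'x.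
- apply: derivable_within_continuous => x; rewrite in_itv/= => /andP[y'x _].
  by apply: ex_derive; apply: dF; exact: lt_le_trans y'x.
rewrite in_itv/= => h E; exists xi => //; rewrite -E /source; ring.
Qed.

Lemma source_incr (y z' z : R) : 0 < y -> 0 < z' -> z' < z -> source y z' < source y z.
Proof.
move=> y0 z'0 z'z; have [xi /andP[z'xi _] E] := source_MVT2 y0 z'0 z'z.
rewrite -subr_gt0 E mulr_gt0 ?subr_gt0// fv//; exact: lt_trans z'xi.
Qed.

(** A Lipschitz bound in which an increase of the second argument costs nothing,
    since the source increases with it. *)
Lemma source_lower (ybar zbar : R) : 0 < ybar -> 0 < zbar ->
  exists2 L : R, 0 <= L & exists2 r : R, 0 < r & forall y' y z' z eta : R,
    `|ybar - y'| < r -> `|ybar - y| < r -> `|zbar - z'| < r -> `|zbar - z| < r ->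
    0 <= eta -> y' <= y -> y - y' <= eta -> z - z' <= eta ->
    - (L * eta) <= source y' z' - source y z.
Proof.
move=> y0 z0; have [_ _ c1 c2] := hf y0 z0.
pose L1 : R := `|partial1 f ybar zbar| + 1; pose L2 : R := `|partial2 f ybar zbar| + 1.
have L10 : 0 < L1 by rewrite ltr_wpDl.
have L20 : 0 < L2 by rewrite ltr_wpDl.
have /nbhs_ballP[r /= r0 rL] : \forall q \near (ybar, zbar),
    partial1 f q.1 q.2 < L1 /\ partial2 f q.1 q.2 < L2.
  near=> q; split; near: q.
    by apply: (cvgr_lt _ c1); rewrite ltr_pwDr// ler_norm.
  by apply: (cvgr_lt _ c2); rewrite ltr_pwDr// ler_norm.
exists (L1 + L2); first by rewrite addr_ge0// ltW.
exists (Num.min r (Num.min ybar zbar)); first by rewrite !lt_min r0 y0.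
move=> y' y z' z eta; rewrite !lt_min.
move=> /and3P[y'r y'y0 _] /and3P[yr yy0 _] /and3P[z'r _ z'z0] /and3P[zr _ zz0].
move=> eta0 y'y yeta zeta.
have pos (t u : R) : `|t - u| < t -> 0 < u by rewrite ltr_norml => /andP[_]; lra.
have {}y'y0 := pos _ _ y'y0; have {}yy0 := pos _ _ yy0.
have {}z'z0 := pos _ _ z'z0; have {}zz0 := pos _ _ zz0.
have btw (t a1 b1 c : R) : `|t - a1| < r -> `|t - c| < r -> a1 < b1 < c -> `|t - b1| < r.
  by rewrite !ltr_norml => /andP[? ?] /andP[? ?] /andP[? ?]; apply/andP; split; lra.
have part1 : - (L1 * eta) <= source y' z' - source y z'.
  move: y'y; rewrite le_eqVlt => /predU1P[->|y'y].
    by rewrite subrr oppr_le0 mulr_ge0// ltW.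
  have [xi xib E] := source_MVT1 y'y0 y'y z'z0.
  rewrite -opprB E lerN2; have xi0 : 0 < xi by case/andP: xib => + _; exact: lt_trans.
  have [/= /ltW h _] := rL (xi, z') (conj (btw _ _ _ _ y'r yr xib) z'r).
  apply: (@le_trans _ _ (L1 * (y - y'))).
    rewrite ler_wpM2r ?subr_ge0 ?(ltW y'y)// (le_trans _ h)// /source1 gerBl.
    by rewrite mulr_ge0 ?powR_ge0// mulr_ge0// ltW.
  by rewrite ler_wpM2l// ltW.
have part2' : - (L2 * eta) <= source y z' - source y z.
  have [zz'|z'z] := leP z z'.
    apply: (@le_trans _ _ 0); first by rewrite oppr_le0 mulr_ge0// ltW.
    move: zz'; rewrite le_eqVlt => /predU1P[->|zz']; first by rewrite subrr.
    by rewrite subr_ge0 ltW// source_incr.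
  have [xi xib E] := source_MVT2 yy0 z'z0 z'z.
  rewrite -opprB E lerN2.
  have [_ /= /ltW h] := rL (y, xi) (conj yr (btw _ _ _ _ z'r zr xib)).
  apply: (@le_trans _ _ (L2 * (z - z'))).
    by rewrite ler_wpM2r ?subr_ge0 ?(ltW z'z).
  by rewrite ler_wpM2l// ltW.
by rewrite mulrDl; lra.
Unshelve. all: by end_near. Qed.

Let small : exists2 d, 0 < d <= 1 & forall y z, 0 < y -> y < d -> 0 < z -> z < d ->
  partial1 f y z <= y `^ (m - 1) * z `^ n /\
  partial2 f y z <= y `^ m * z `^ (n - 1).
Proof.
have [[A B] /= [/nbhs_ballP[d1 /= d10 HA] /nbhs_ballP[d2 /= d20 HB]] AB] := fsmall.
exists (Num.min 1 (Num.min d1 d2)); first by rewrite !lt_min ltr01 d10 d20 ge_min lexx.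
move=> y z y0; rewrite !lt_min => /and3P[_ yd1 _] z0 /and3P[_ _ zd2].
apply: (AB (y, z)); split => /=.
  by apply: HA => //; rewrite /ball/= sub0r normrN gtr0_norm.
by apply: HB => //; rewrite /ball/= sub0r normrN gtr0_norm.
Qed.

Let powR_le1 (x b : R) : 0 < x <= 1 -> 0 <= b -> x `^ b <= 1.
Proof. by move=> x01 b0; rewrite -(powRr0 x) ger_powR. Qed.

(** For xi below a fixed small y2 the derivative at xi is smaller than the one at
    y2, which is at most z - 2 * c0 by the growth condition. So the derivative
    stays away from 0 although the power y `^ (p - 2) itself vanishes at 0. *)
Lemma source_decr_near0 : exists2 c0 : R, 0 < c0 & exists2 r0 : R, 0 < r0 &
  forall y' y z : R, 0 < y' -> y' <= y -> y < r0 -> 0 < z -> z < r0 ->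
    c0 * (y - y') <= source y' z - source y z.
Proof.
have [e e0 fi] := fincr; have [d /andP[d0 d1] sm] := small.
pose y2 := Num.min e d / 2.
have ed0 : 0 < Num.min e d by rewrite lt_min e0.
have y20 : 0 < y2 by rewrite divr_gt0.
have y2ed : y2 < Num.min e d by rewrite ltr_pdivrMr// ltr_pMr// ltr1n.
have [y2e y2d] : y2 < e /\ y2 < d by apply/andP; rewrite -lt_min.
pose c0 := a * (p - 1) * y2 `^ (p - 2) / 2.
have c00 : 0 < c0.
  by rewrite divr_gt0// mulr_gt0 ?powR_gt0// mulr_gt0.
exists c0 => //; exists (Num.min y2 (Num.min c0 d)).
  by rewrite !lt_min y20 c00 d0.
move=> y' y z y'0; rewrite le_eqVlt => /predU1P[-> *|y'y].
  by rewrite !subrr mulr0.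
rewrite !lt_min => /and3P[yy2 _ _] z0 /and3P[_ zc0 zd].
have [xi /andP[y'xi xiy] E] := source_MVT1 y'0 y'y z0.
rewrite -[leRHS]opprB E -mulNr ler_pM2r ?subr_gt0// lerNr.
have xi0 : 0 < xi by exact: lt_trans y'xi.
have : source1 xi z < source1 y2 z.
  apply: fi => //; rewrite ?in_itv/= ?xi0 ?y20//=.
    by rewrite (lt_trans xiy)// (lt_trans yy2).
  exact: lt_trans yy2.
move=> /ltW /le_trans; apply.
have [+ _] := sm y2 z y20 y2d z0 zd; rewrite /source1.
have y2p : y2 `^ (m - 1) * z `^ n <= z.
  have m10 : 0 <= m - 1 by rewrite subr_ge0.
  have zn : z `^ n <= z by apply: ge1r_powR => //; rewrite z0/= (le_trans (ltW zd)).
  have y21 : y2 `^ (m - 1) <= 1 by apply: powR_le1 => //; rewrite y20 (le_trans (ltW y2d)).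
  apply: (@le_trans _ _ (1 * z `^ n)); last by rewrite mul1r.
  by rewrite ler_wpM2r// powR_ge0.
have -> : a * (p - 1) * y2 `^ (p - 2) = 2 * c0 by rewrite /c0; field.
by move=> h; lra.
Qed.

Lemma source_flat_near0 (eps : R) : 0 < eps -> exists2 r0 : R, 0 < r0 &
  forall y z' z : R, 0 < y -> y < r0 -> 0 < z' -> z' <= z -> z < r0 ->
    source y z - source y z' <= eps * (z - z').
Proof.
move=> eps0; have [d /andP[d0 d1] sm] := small.
exists (Num.min eps d); first by rewrite lt_min eps0.
move=> y z' z y0; rewrite lt_min => /andP[yeps yd] z'0.
rewrite le_eqVlt => /predU1P[-> *|z'z]; first by rewrite !subrr mulr0.
rewrite lt_min => /andP[zeps zd].
have [xi /andP[z'xi xiz] ->] := source_MVT2 y0 z'0 z'z.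
rewrite ler_pM2r ?subr_gt0//.
have xi0 : 0 < xi by exact: lt_trans z'xi.
have xid : xi < d by exact: lt_trans zd.
have [_ /le_trans] := sm y xi y0 yd xi0 xid; apply.
have ym : y `^ m <= y.
  by apply: ge1r_powR; rewrite ?y0 ?(le_trans (ltW yd)).
have xin : xi `^ (n - 1) <= 1.
  by apply: powR_le1; rewrite ?xi0 ?(le_trans (ltW xid))// subr_ge0.
apply: (@le_trans _ _ (y `^ m * 1)); first by rewrite ler_wpM2l// powR_ge0.
by rewrite mulr1 (le_trans ym)// ltW.
Qed.

End nonlinearity.

(** * Maximum principles for the moving plane *)

Section moving_planes.
Context {R : realType} {N : nat}.
Implicit Types (x y e : 'rV[R]_N) (w u v : 'rV[R]_N -> R) (mu : R).

Definition refl_ge e mu w := forall x, dot x e < mu -> w x <= w (refl e mu x).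

Definition negative_min e mu w x := [/\ dot x e < mu,
  w (refl e mu x) - w x < 0 &
  forall y, dot y e < mu -> w (refl e mu x) - w x <= w (refl e mu y) - w y].

(** This and the two following properties isolate what the moving plane argument
    uses of one equation; each is needed for (u, v) and for (v, u). *)
Definition far_dominated u v := exists rho, forall e mu x, dot e e = 1 ->
  rho < enorm x -> negative_min e mu u x ->
  v (refl e mu x) - v x < u (refl e mu x) - u x.

Definition strong_max u v := forall e mu, dot e e = 1 ->
  refl_ge e mu u -> refl_ge e mu v ->
  (exists2 x, dot x e < mu & u (refl e mu x) = u x) ->
  forall x, dot x e < mu -> u (refl e mu x) = u x /\ v (refl e mu x) = v x.

Definition boundary_free u v := forall e lam0 xbar, dot e e = 1 ->
  refl_ge e lam0 u -> refl_ge e lam0 v ->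
  (forall x, dot x e < lam0 -> u x < u (refl e lam0 x)) ->
  dot xbar e = lam0 ->
  \forall x \near xbar & mu \near lam0, ~ negative_min e mu u x.

Section principles.
Variables (u v : 'rV[R]_N -> R) (F : R -> R -> R).
Hypothesis cu : continuous u.
Hypothesis cv : continuous v.
Hypothesis u0 : forall x, 0 < u x.
Hypothesis v0 : forall x, 0 < v x.
Hypothesis vu : vanishing u.
Hypothesis vv : vanishing v.
Hypothesis u11 : C11_loc u.
Hypothesis v11 : C11_loc v.
Hypothesis F_incr : forall y z' z : R, 0 < y -> 0 < z' -> z' < z -> F y z' < F y z.
Hypothesis F_lower : forall ybar zbar : R, 0 < ybar -> 0 < zbar ->
  exists2 L : R, 0 <= L & exists2 r : R, 0 < r & forall y' y z' z eta : R,
    `|ybar - y'| < r -> `|ybar - y| < r -> `|zbar - z'| < r -> `|zbar - z| < r ->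
    0 <= eta -> y' <= y -> y - y' <= eta -> z - z' <= eta ->
    - (L * eta) <= F y' z' - F y z.
Hypothesis F_decr : exists2 c0 : R, 0 < c0 & exists2 r0 : R, 0 < r0 &
  forall y' y z : R, 0 < y' -> y' <= y -> y < r0 -> 0 < z -> z < r0 ->
    c0 * (y - y') <= F y' z - F y z.
Hypothesis F_flat : forall eps : R, 0 < eps -> exists2 r0 : R, 0 < r0 &
  forall y z' z : R, 0 < y -> y < r0 -> 0 < z' -> z' <= z -> z < r0 ->
    F y z - F y z' <= eps * (z - z').
Hypothesis pde_le : forall e mu x, dot e e = 1 -> dot x e < mu ->
  u (refl e mu x) <= u x ->
  (forall y, dot y e < mu ->
     u (refl e mu x) - u x <= u (refl e mu y) - u y) ->
  F (u (refl e mu x)) (v (refl e mu x)) <= F (u x) (v x).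
Hypothesis pde_near : forall e lam0 xbar y0, dot e e = 1 -> dot y0 e < lam0 ->
  u (refl e lam0 xbar) <= u xbar -> u y0 < u (refl e lam0 y0) ->
  exists2 kappa0 : R, 0 < kappa0 & \forall x \near xbar & mu \near lam0,
    dot x e < mu -> u (refl e mu x) <= u x ->
    (forall y, dot y e < mu ->
       u (refl e mu x) - u x <= u (refl e mu y) - u y) ->
    F (u (refl e mu x)) (v (refl e mu x)) - F (u x) (v x) <=
    - (kappa0 * (mu - dot x e)).

(** If v did not decrease under the reflection, F would increase both through its
    first and through its second argument, against the comparison. If it does
    decrease, the gain c0 * (u x - u (x^mu)) is compensated by the loss, which is
    at most (c0 / 2) * (v x - v (x^mu)). *)
Lemma far_dominatedP : far_dominated u v.
Proof.
have [c0 c00 [r0 r00 Fd]] := F_decr.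
have [r1 r10 Ff] := F_flat (divr_gt0 c00 (ltr0n R 2)).
pose r := Num.min r0 r1; have r_gt0 : 0 < r by rewrite lt_min r00.
have [rho1 urho] := vu r_gt0; have [rho2 vrho] := vv r_gt0.
exists (Num.max rho1 rho2) => e mu x e1; rewrite gt_max => /andP[xr1 xr2].
move=> [xmu Ux Umin].
have := urho _ xr1; rewrite lt_min => /andP[ux0 ux1].
have := vrho _ xr2; rewrite lt_min => /andP[vx0 vx1].
have uu : u (refl e mu x) < u x by rewrite -subr_lt0.
have := pde_le e1 xmu (ltW uu) Umin.
have := Fd _ _ _ (u0 (refl e mu x)) (ltW uu) ux0 (v0 x) vx0.
have := u0 (refl e mu x); have := v0 (refl e mu x); have := v0 x.
move: uu ux1 vx1.
move: (u (refl e mu x)) (u x) (v (refl e mu x)) (v x) => u' u1 v' v1.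
move=> uu ux1 vx1 v1_gt0 v'_gt0 u'_gt0 H1 H2.
have gain : 0 < c0 * (u1 - u') by rewrite mulr_gt0// subr_gt0.
have [vv'|v'v] := leP v1 v'.
  have : F u' v1 <= F u' v'.
    by move: vv'; rewrite le_eqVlt => /predU1P[->//|?]; rewrite ltW// F_incr.
  by move=> h; lra.
have := Ff _ _ _ u'_gt0 (lt_trans uu ux1) v'_gt0 (ltW v'v) vx1 => H3.
have H4 : c0 * (u1 - u') <= c0 * ((v1 - v') / 2).
  by rewrite mulrA mulrAC; lra.
by move: H4; rewrite ler_pM2l// => H4; lra.
Qed.

(** At a zero of the reflected difference of u, the comparison gains strictly if
    that difference is positive somewhere, whereas F cannot decrease because
    only its second argument changes, upwards. Once the difference vanishes
    identically, the comparison holds at every point and forces v to be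
    symmetric too. *)
Lemma strong_maxP : strong_max u v.
Proof.
move=> e mu e1 ru rv [x0 x0mu ux0].
have U0 y : dot y e < mu -> u (refl e mu y) = u y.
  move=> ymu; apply/eqP; rewrite eq_le ru// andbT leNgt; apply/negP => uy.
  have ux0' : u (refl e mu x0) <= u x0 by rewrite ux0.
  have [k k0 Hk] := pde_near e1 ymu ux0' uy.
  have /= /(_ x0mu ux0') := @nbhs_singleton _ (x0, mu) _ Hk.
  have Umin z : dot z e < mu ->
      u (refl e mu x0) - u x0 <= u (refl e mu z) - u z.
    by move=> zmu; rewrite ux0 subrr subr_ge0 ru.
  move=> /(_ Umin).
  apply/negP; rewrite -ltNge; apply: (@lt_le_trans _ _ 0).
    by rewrite oppr_lt0 mulr_gt0// subr_gt0.
  rewrite subr_ge0 ux0; have := rv _ x0mu.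
  by rewrite le_eqVlt => /predU1P[<-//|?]; rewrite ltW// F_incr.
move=> x xmu; split; first exact: U0.
apply/eqP; rewrite eq_le rv// andbT leNgt; apply/negP => vx.
have ux : u (refl e mu x) <= u x by rewrite U0.
have /(pde_le e1 xmu ux) : forall y, dot y e < mu ->
    u (refl e mu x) - u x <= u (refl e mu y) - u y.
  by move=> y ymu; rewrite !U0// !subrr.
rewrite U0//.
by apply/negP; rewrite -ltNge F_incr.
Qed.

(** The comparison has the gain k * (mu - x . e), and F decreases at most by
    L * eps * (mu - x . e) since u and v lose at most eps * (mu - x . e) under the
    reflection; eps is chosen so that L * eps < k. *)
Lemma boundary_freeP : boundary_free u v.
Proof.
move=> e lam0 xbar e1 ru rv Upos xl.
have y0l : dot (xbar - e) e < lam0 by rewrite !dotE e1 xl; lra.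
have uxbar : u (refl e lam0 xbar) <= u xbar by rewrite refl_fix.
have [k k0 Hk] := pde_near e1 y0l uxbar (Upos _ y0l).
have [L L0 [r r0 HL]] := F_lower (u0 xbar) (v0 xbar).
have L1 : 0 < L + 1 by rewrite ltr_wpDl.
pose eps := k / (L + 1); have eps0 : 0 < eps by rewrite divr_gt0.
have Su := slope_near u11 e1 xl ru eps0.
have Sv := slope_near v11 e1 xl rv eps0.
pose P := ('rV[R]_N * R)%type.
have cx : (fun z : P => z.1) @ (xbar, lam0) --> xbar by exact: cvg_fst.
have cm : (fun z : P => z.2) @ (xbar, lam0) --> lam0 by exact: cvg_snd.
have near_val w : continuous w -> \forall z \near (xbar, lam0),
    `|w xbar - w z.1| < r /\ `|w xbar - w (refl e z.2 z.1)| < r.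
  move=> cw; have rx : refl e lam0 xbar = xbar by rewrite refl_fix.
  have FF : Filter (nbhs (xbar, lam0)) by exact: nbhs_filter.
  have c1 := continuous_cvg FF (cw xbar) cx.
  have c2 : refl e z.2 z.1 @[z --> (xbar, lam0)] --> xbar.
    by rewrite -[X in _ --> X]rx; apply: cvg_hrefl.
  have c3 := continuous_cvg FF (cw xbar) c2.
  near=> z; split; near: z.
    have H := @cvgr_dist_lt _ _ _ _ FF _ _ c1 _ r0. exact: H.
  have H := @cvgr_dist_lt _ _ _ _ FF _ _ c3 _ r0. exact: H.
have Nu := near_val u cu; have Nv := near_val v cv.
have FF : Filter (nbhs (xbar, lam0)) by exact: nbhs_filter.
have HH := @filterI _ _ FF _ _ Hk (@filterI _ _ FF _ _ Su (@filterI _ _ FF _ _ Sv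
  (@filterI _ _ FF _ _ Nu Nv))).
apply: (@filterS _ _ FF _ _ _ HH) => z /= [h1 [h2 [h3 [[h4 h5] [h6 h7]]]]].
move=> [xmu Ux Umin].
  have uu : u (refl e z.2 z.1) < u z.1 by rewrite -subr_lt0.
  have {}h1 := h1 xmu (ltW uu) Umin.
  have {}h2 := h2 xmu.
  have {}h3 := h3 xmu.
  have d0 : 0 < z.2 - dot z.1 e by rewrite subr_gt0.
  have h8 := HL _ _ _ _ (eps * (z.2 - dot z.1 e)) h5 h4 h7 h6
    (ltW (mulr_gt0 eps0 d0)) (ltW uu).
  have h9 : - (L * (eps * (z.2 - dot z.1 e))) <= - (k * (z.2 - dot z.1 e)).
    by apply: le_trans h1; apply: h8; lra.
  move: h9; rewrite lerN2 mulrA ler_pM2r// /eps mulrA ler_pdivlMr// => h9; lra.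
Unshelve. all: by end_near. Qed.

End principles.
End moving_planes.

(** * Symmetry in a given direction *)

Section direction.
Context {R : realType} {N : nat}.
Implicit Types (x y e : 'rV[R]_N) (w u v : 'rV[R]_N -> R) (mu : R).

Lemma refl_ge_or_negative_min w e mu : dot e e = 1 -> continuous w ->
  (forall x, 0 < w x) -> vanishing w ->
  refl_ge e mu w \/ exists x, negative_min e mu w x.
Proof.
move=> e1 cw w0 vw; have [h|] := pselect (refl_ge e mu w); first by left.
move=> /existsNP[y /not_implyP[ymu /negP]]; rewrite -ltNge -subr_lt0 => Uy.
by right; exact: negative_min_attained Uy.
Qed.

Section pair.
Variables (u v : 'rV[R]_N -> R).
Hypothesis cu : continuous u.

(** Below the limiting hyperplane the reflected difference stays positive, above
    it the point has left the half-space, and on it the boundary property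
    applies. *)
Lemma local_no_negative_min e (lam0 : R) (xbar : 'rV[R]_N) : dot e e = 1 -> boundary_free u v ->
  refl_ge e lam0 u -> refl_ge e lam0 v ->
  (forall x, dot x e < lam0 -> u x < u (refl e lam0 x)) ->
  \forall x \near xbar & mu \near lam0, ~ negative_min e mu u x.
Proof.
move=> e1 bf ru rv Upos.
have [xl|lx|xl] := ltgtP (dot xbar e) lam0; last exact: (bf e lam0).
- have FF : Filter (nbhs (xbar, lam0)) by exact: nbhs_filter.
  pose P := ('rV[R]_N * R)%type.
  have cx : (fun z : P => z.1) @ (xbar, lam0) --> xbar by exact: cvg_fst.
  have cm : (fun z : P => z.2) @ (xbar, lam0) --> lam0 by exact: cvg_snd.
  have Upos' : 0 < u (refl e lam0 xbar) - u xbar by rewrite subr_gt0 Upos.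
  have H : \forall z \near (xbar, lam0), 0 < u (refl e z.2 z.1) - u z.1.
    by apply: (cvgr_gt _ (cvg_refl_diff (e := e) cu cx cm)).
  apply: (@filterS _ _ FF _ _ _ H) => z /= Uz [_ Uz' _].
  by move: (lt_trans Uz Uz'); rewrite ltxx.
have FF : Filter (nbhs (xbar, lam0)) by exact: nbhs_filter.
pose P := ('rV[R]_N * R)%type.
have cx : (fun z : P => z.1) @ (xbar, lam0) --> xbar by exact: cvg_fst.
have cm : (fun z : P => z.2) @ (xbar, lam0) --> lam0 by exact: cvg_snd.
have lx' : 0 < dot xbar e - lam0 by rewrite subr_gt0.
have H : \forall z \near (xbar, lam0), 0 < dot z.1 e - z.2.
  by apply: (cvgr_gt _ (cvgB (cvg_dot cx (cvg_cst e)) cm)).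
apply: (@filterS _ _ FF _ _ _ H) => z /= h [+ _ _].
by rewrite ltNge -subr_ge0 ltW.
Qed.

End pair.

Section supremum.
Variables (u v : 'rV[R]_N -> R).
Hypothesis cu : continuous u.
Hypothesis cv : continuous v.
Hypothesis u0 : forall x, 0 < u x.
Hypothesis v0 : forall x, 0 < v x.
Hypothesis vu : vanishing u.
Hypothesis vv : vanishing v.
Hypothesis far_uv : far_dominated u v.
Hypothesis far_vu : far_dominated v u.
Hypothesis smp_uv : strong_max u v.
Hypothesis smp_vu : strong_max v u.
Hypothesis bdy_uv : boundary_free u v.
Hypothesis bdy_vu : boundary_free v u.

(** A far negative minimum of one difference produces a strictly lower value of
    the other. If both minima were far, each would lie strictly below the
    other. *)
Lemma refl_ge_of_box : exists rho, forall e mu, dot e e = 1 ->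
  (forall x, enorm x <= rho -> ~ negative_min e mu u x /\ ~ negative_min e mu v x) ->
  refl_ge e mu u /\ refl_ge e mu v.
Proof.
have [r1 H1] := far_uv; have [r2 H2] := far_vu.
exists (Num.max r1 r2) => e mu e1 H.
have Hu x : negative_min e mu u x -> v (refl e mu x) - v x < u (refl e mu x) - u x.
  move=> nx; apply: H1 => //; rewrite ltNge; apply/negP => xr.
  by have [] := H x _; rewrite ?le_max ?xr//.
have Hv x : negative_min e mu v x -> u (refl e mu x) - u x < v (refl e mu x) - v x.
  move=> nx; apply: H2 => //; rewrite ltNge; apply/negP => xr.
  by have [] := H x _; rewrite ?le_max ?xr ?orbT//.
have [ru|[x nx]] := refl_ge_or_negative_min mu e1 cu u0 vu;
  have [rv|[y ny]] := refl_ge_or_negative_min mu e1 cv v0 vv => //.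
- have [ymu Vy _] := ny; have := ru _ ymu; rewrite -subr_ge0 => h.
  by have := Hv _ ny; lra.
- have [xmu Ux _] := nx; have := rv _ xmu; rewrite -subr_ge0 => h.
  by have := Hu _ nx; lra.
have [xmu _ xmin] := nx; have [ymu _ ymin] := ny.
have := Hu _ nx; have := Hv _ ny; have := xmin _ ymu; have := ymin _ xmu.
by lra.
Qed.

Lemma refl_eq_all e mu w : dot e e = 1 ->
  (forall x, dot x e < mu -> w (refl e mu x) = w x) ->
  forall x, w (refl e mu x) = w x.
Proof.
move=> e1 h x; have [xmu|mux|xmu] := ltgtP (dot x e) mu; first exact: h.
  by have := h (refl e mu x); rewrite reflK// dot_refl// => ->//; lra.
by rewrite refl_fix.
Qed.

(** Two parallel symmetry hyperplanes compose to a translation, and a positive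
    function tending to 0 at infinity has no period. *)
Lemma symmetry_plane_unique w e mu lam0 : dot e e = 1 -> mu < lam0 ->
  (forall x, 0 < w x) -> vanishing w ->
  (forall x, w (refl e mu x) = w x) -> (forall x, w (refl e lam0 x) = w x) -> False.
Proof.
move=> e1 mul w0 vw smu slam.
pose T := 2 * (lam0 - mu); have T0 : 0 < T by rewrite mulr_gt0// subr_gt0.
have per x : w (x + T *: e) = w x.
  have -> : x + T *: e = refl e lam0 (refl e mu x).
    rewrite {1}/refl dot_refl// /refl -addrA -scalerDl.
    by congr (_ + _ *: _); rewrite /T; ring.
  by rewrite slam smu.
have perk k : w ((k%:R * T) *: e) = w 0.
  elim: k => [|k <-]; first by rewrite mul0r scale0r.
  by rewrite -[RHS]per -scalerDl -natr1 mulrDl mul1r.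
have [rho wrho] := vw _ (w0 0).
pose k := (Num.truncn (`|rho| / T)).+1.
have : rho < enorm ((k%:R * T) *: e).
  rewrite enormE !dotE e1 mulr1 -expr2 sqrtr_sqr ger0_norm; last first.
    by rewrite mulr_ge0// ltW.
  rewrite (le_lt_trans (ler_norm _))// -ltr_pdivrMr// /k.
  by rewrite truncnS_gt.
by move=> /wrho; rewrite perk ltxx.
Qed.

(** The critical position is the supremum of the set S below. It is a real number
    since S contains every sufficiently negative level, and since reflecting 0
    in a far hyperplane gives values of u below u 0. *)
Lemma symmetry_direction e : dot e e = 1 -> exists lam0,
  [/\ forall x, u (refl e lam0 x) = u x, forall x, v (refl e lam0 x) = v x &
   forall mu x, mu < lam0 -> dot x e < mu ->
     u x < u (refl e mu x) /\ v x < v (refl e mu x)].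
Proof.
move=> e1; have [rho Hrho] := refl_ge_of_box.
pose S := [set l | forall mu, mu <= l -> refl_ge e mu u /\ refl_ge e mu v].
have S0 : S (- `|rho| - 1).
  move=> mu mul; apply: Hrho => // x xr.
  have xe : mu <= dot x e.
    have := dot_le_enorm x e1; rewrite ler_norml => /andP[h _].
    by have := ler_norm rho; lra.
  by split=> -[+ _ _]; rewrite ltNge xe.
have [rho1 urho] := vu (u0 0).
have Sb : ubound S (Num.max 1 rho1).
  move=> l Sl; rewrite leNgt; apply/negP; rewrite gt_max => /andP[l1 lr].
  have [ru _] := Sl l (lexx l).
  have l0 : 0 < l by rewrite (lt_trans _ l1).
  have := ru 0; rewrite dot0l => /(_ l0); apply/negP; rewrite -ltNge.
  apply: urho; rewrite /refl dot0l subr0 add0r enormE !dotE e1 mulr1 -expr2.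
  by rewrite sqrtr_sqr gtr0_norm ?mulr_gt0//; lra.
have supS : has_sup S by split; [exists (- `|rho| - 1) | exists (Num.max 1 rho1)].
pose lam0 := sup S.
have below mu : mu < lam0 -> refl_ge e mu u /\ refl_ge e mu v.
  move=> mul; have mul' : 0 < lam0 - mu by rewrite subr_gt0.
  have [l Sl] := sup_adherent mul' supS; rewrite -/lam0 subKr => /ltW; exact: Sl.
(* nonnegativity is a closed condition, so it passes to the supremum *)
have at0 w : continuous w -> (forall mu, mu < lam0 -> refl_ge e mu w) ->
    refl_ge e lam0 w.
  move=> cw h x xl; rewrite -subr_ge0.
  have c : w (refl e mu x) - w x @[mu --> lam0^'-] --> w (refl e lam0 x) - w x.
    apply: cvg_refl_diff => //; first exact: cvg_cst.
    by apply: cvg_at_left_filter; exact: cvg_id.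
  apply: (cvgr_to_ge c); near=> mu; rewrite subr_ge0; apply: h.
    by near: mu; exact: nbhs_left_lt.
  by near: mu; exact: nbhs_left_gt.
have ru0 : refl_ge e lam0 u by apply: at0 => // mu /below[].
have rv0 : refl_ge e lam0 v by apply: at0 => // mu /below[].
have sym : forall x, dot x e < lam0 ->
    u (refl e lam0 x) = u x /\ v (refl e lam0 x) = v x.
  apply: contrapT => nsym.
  have pu x : dot x e < lam0 -> u x < u (refl e lam0 x).
    move=> xl; rewrite lt_neqAle ru0// andbT; apply/eqP => ux; apply: nsym.
    by apply: smp_uv => //; exists x.
  have pv x : dot x e < lam0 -> v x < v (refl e lam0 x).
    move=> xl; rewrite lt_neqAle rv0// andbT; apply/eqP => vx; apply: nsym.
    have h : exists2 x, dot x e < lam0 & v (refl e lam0 x) = v x by exists x.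
    by move=> y yl; have [] := smp_vu e1 rv0 ru0 h yl.
  (* the local statements are uniform on the compact box *)
  have : \forall mu \near lam0, forall x, box rho x ->
      ~ negative_min e mu u x /\ ~ negative_min e mu v x.
    have := (compact_near_coveringP _).1 (@compact_box R N rho) _ (nbhs lam0)
      (fun mu x => ~ negative_min e mu u x /\ ~ negative_min e mu v x) _.
    apply => x _.
    have FF : Filter (nbhs (x, lam0)) by exact: nbhs_filter.
    exact: (@filterI _ _ FF _ _
      (local_no_negative_min cu x e1 bdy_uv ru0 rv0 pu)
      (local_no_negative_min cv x e1 bdy_vu rv0 ru0 pv)).
  move=> /nbhs_ballP[d /= d0 Hd].
  have : S (lam0 + d / 2).
    move=> mu mud; have [/below//|lmu] := ltP mu lam0.
    apply: Hrho => // x xr; apply: Hd; last first.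
      by apply: contrapT => /not_box; rewrite ltNge xr.
    rewrite /ball/= distrC ger0_norm ?subr_ge0//.
    have : d / 2 < d by rewrite ltr_pdivrMr// ltr_pMr// ltr1n.
    by lra.
  move=> /(ub_le_sup supS.2); rewrite -/lam0 leNgt ltrDl.
  by rewrite divr_gt0.
have su : forall x, u (refl e lam0 x) = u x by apply: refl_eq_all => // x /sym[].
have sv : forall x, v (refl e lam0 x) = v x by apply: refl_eq_all => // x /sym[].
exists lam0; split => // mu x mul xmu; have [ru rv] := below _ mul.
split.
  rewrite lt_neqAle ru// andbT; apply/eqP => ux.
  apply: (@symmetry_plane_unique u e mu lam0) => //.
  apply: refl_eq_all => // y ymu.
  have h : exists2 x, dot x e < mu & u (refl e mu x) = u x by exists x.
  by have [] := smp_uv e1 ru rv h ymu.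
rewrite lt_neqAle rv// andbT; apply/eqP => vx.
apply: (@symmetry_plane_unique v e mu lam0) => //.
apply: refl_eq_all => // y ymu.
have h : exists2 x, dot x e < mu & v (refl e mu x) = v x by exists x.
by have [] := smp_vu e1 rv ru h ymu.
Unshelve. all: by end_near. Qed.

End supremum.
End direction.

(** * From directions to radial symmetry *)

Section radial.
Context {R : realType} {N : nat}.
Implicit Types (x y e : 'rV[R]_N) (w u v : 'rV[R]_N -> R).

Lemma exists_max w : continuous w -> (forall x, 0 < w x) -> vanishing w ->
  exists x0, forall x, w x <= w x0.
Proof.
move=> cw w0 vw; have [rho wrho] := vw _ (w0 0).
have [|c _ cmax] := EVT_max_rV (f := w) (A := box `|rho|) _ (@compact_box _ _ _)
    (continuous_subspaceT cw).
  by exists 0 => i; rewrite mxE in_itv/= oppr_le0 normr_ge0.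
exists c => x; have [xb|/not_box xb] := pselect (box `|rho| x).
  by apply: cmax; rewrite inE.
apply: (@le_trans _ _ (w 0)); first by rewrite ltW// wrho// (le_lt_trans (ler_norm _)).
by apply: cmax; rewrite inE => i; rewrite mxE in_itv/= oppr_le0 normr_ge0.
Qed.

(** Off the symmetry hyperplane, a maximum point or its mirror image would lie in
    the half-space where reflecting across a later plane increases w. *)
Lemma max_on_plane w e lam0 x0 : dot e e = 1 -> (forall x, w x <= w x0) ->
  (forall x, w (refl e lam0 x) = w x) ->
  (forall mu x, mu < lam0 -> dot x e < mu -> w x < w (refl e mu x)) ->
  dot x0 e = lam0.
Proof.
move=> e1 wmax sym incr.
have half y : (forall x, w x <= w y) -> lam0 <= dot y e.
  move=> ymax; rewrite leNgt; apply/negP => yl.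
  have h1 : (dot y e + lam0) / 2 < lam0 by lra.
  have h2 : dot y e < (dot y e + lam0) / 2 by lra.
  by have := incr _ _ h1 h2; rewrite ltNge ymax.
apply/eqP; rewrite eq_le half// andbT.
have := half (refl e lam0 x0); rewrite dot_refl// => H.
by have : lam0 <= 2 * lam0 - dot x0 e; [apply: H => x; rewrite sym|lra].
Qed.

(** The perpendicular bisector of x and y; the formula compares the position of
    an arbitrary centre x0 with it through the distances to x and y. *)
Lemma refl_swap x y : x != y -> exists e mu, [/\ dot e e = 1, refl e mu y = x,
  dot y e < mu & forall x0, mu - dot x0 e =
    (enorm (x - x0) ^+ 2 - enorm (y - x0) ^+ 2) / (2 * enorm (x - y))].
Proof.
move=> xy; have d0 : 0 < enorm (x - y) by rewrite enorm_gt0 subr_eq0.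
set d := enorm (x - y) in d0 *.
have dd : d ^+ 2 = dot (x - y) (x - y) by exact: enorm_sqr.
have dn0 : d != 0 by rewrite gt_eqF.
pose e := d^-1 *: (x - y).
have e1 : dot e e = 1 by rewrite /e dotZl dotZr -dd; field.
pose mu := (dot x e + dot y e) / 2.
have de z : dot z e = d^-1 * (dot z x - dot z y) by rewrite /e dotZr dotDr dotNr.
have xye : dot x e - dot y e = d.
  rewrite !de (dotC y x) -mulrBr.
  have -> : dot x x - dot x y - (dot x y - dot y y) = d ^+ 2.
    by rewrite dd !dotE (dotC y x); ring.
  by field.
exists e, mu; split => //.
- rewrite /refl (_ : 2 * (mu - dot y e) = d); last by rewrite /mu; lra.
  by rewrite /e scalerA divff// scale1r addrC subrK.
- by rewrite /mu; lra.
move=> x0; rewrite !enorm_sqr /mu !de !dotE (dotC y x) (dotC x0 x) (dotC x0 y).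
by field.
Qed.

(** All symmetry hyperplanes meet in a maximum point x0 of u. If x and y are
    equally far from x0, their bisector contains x0 and is the symmetry
    hyperplane for its direction; if x is closer, the bisector is met before
    the symmetry hyperplane, and reflecting y to x increases both functions. *)
Lemma radial_of_directions u v :
  continuous u -> (forall x, 0 < u x) -> vanishing u ->
  continuous v -> (forall x, 0 < v x) -> vanishing v ->
  (forall e, dot e e = 1 -> exists lam0,
  [/\ forall x, u (refl e lam0 x) = u x, forall x, v (refl e lam0 x) = v x &
   forall mu x, mu < lam0 -> dot x e < mu ->
     u x < u (refl e mu x) /\ v x < v (refl e mu x)]) ->
  exists x0, [/\ radially_symmetric_about x0 u, radially_decreasing_about x0 u,
        radially_symmetric_about x0 v & radially_decreasing_about x0 v].
Proof.
move=> cu u0 vu cv v0 vv dir; have [x0 umax] := exists_max cu u0 vu.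
have plane e lam0 : dot e e = 1 -> (forall x, u (refl e lam0 x) = u x) ->
    (forall mu x, mu < lam0 -> dot x e < mu -> u x < u (refl e mu x) /\ v x < v (refl e mu x)) ->
    dot x0 e = lam0.
  move=> e1 su incr; apply: max_on_plane e1 umax su _ => mu x h1 h2.
  by have [] := incr mu x h1 h2.
have sym x y : enorm (x - x0) = enorm (y - x0) -> u x = u y /\ v x = v y.
  move=> xy; have [->//|nxy] := eqVneq x y.
  have [e [mu [e1 yx _ /(_ x0)]]] := refl_swap nxy.
  rewrite xy subrr mul0r => /eqP; rewrite subr_eq0 => /eqP mux0.
  rewrite -yx mux0.
  have [lam0 [su sv incr]] := dir e e1.
  by rewrite (plane e lam0).
have decr x y : enorm (x - x0) < enorm (y - x0) -> u y < u x /\ v y < v x.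
  move=> xy; have nxy : x != y by apply: contraTneq xy => ->; rewrite ltxx.
  have [e [mu [e1 yx ymu /(_ x0) mux0]]] := refl_swap nxy.
  have [lam0 [su sv incr]] := dir e e1.
  have pl := plane e lam0 e1 su incr.
  rewrite -yx; apply: incr => //; rewrite -pl -subr_lt0 mux0.
  rewrite pmulr_llt0; last by rewrite invr_gt0 mulr_gt0// enorm_gt0 subr_eq0.
  by rewrite subr_lt0 ltr_sqr ?nnegrE ?enorm_ge0.
by exists x0; split=> x y h; [have [] := sym x y h | have [] := decr x y h |
  have [] := sym x y h | have [] := decr x y h].
Qed.

End radial.

(** * The two equations together *)

Section equation_to_principles.
Context {R : realType} {N : nat}.

Lemma moving_plane_principles (p s a C m n : R) (f : R -> R -> R) (u v : 'rV[R]_N -> R) :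
  (2 <= N)%N -> 0 < s -> 2 < p -> 0 < a -> 0 < C -> C1_quadrant f ->
  C11_loc u -> Lsp_space p s u -> continuous u ->
  C11_loc v -> continuous v ->
  (forall x, 0 < u x) -> (forall x, 0 < v x) ->
  (forall x, exists2 l, is_frac_plap C p s u x l &
       l + a * u x `^ (p - 1) = f (u x) (v x)) ->
  (forall y z : R, 0 < y -> 0 < z -> 0 < partial2 f y z) ->
  (\forall y \near 0^'+ & z \near 0^'+,
       partial1 f y z <= y `^ (m - 1) * z `^ n /\
       partial2 f y z <= y `^ m * z `^ (n - 1)) ->
  (exists2 e : R, 0 < e & forall z : R, 0 < z ->
       {in `]0, e[ &, {homo (fun y => partial1 f y z
          - a * (p - 1) * y `^ (p - 2)) : y1 y2 / y1 < y2}}) ->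
  vanishing u -> vanishing v -> p - 1 <= m -> 1 <= n ->
  [/\ far_dominated u v, strong_max u v & boundary_free u v].
Proof.
move=> N2 s0 p2 a0 C0 hf u11 uL cu v11 cv u0 v0 equ fv fsmall fincr vu vv hm hn.
have [M uM] := vanishing_bounded cu u0 vu.
have kint := cutker_integrable p2 s0 u0 uL.
have meas_u : measurable_fun setT u by case: uL => -[].
have eqF x : exists2 I, frac_plap_trunc p s u x eps @[eps --> 0^'+] --> I%:E &
    C * I = source p a f (u x) (v x).
  have [l [I cI lE] fE] := equ x; exists I => //.
  by rewrite /source -fE lE addrK.
have ple := pde_le N2 p2 s0 C0 kint meas_u uM eqF.
have pnear := pde_near N2 p2 s0 C0 kint meas_u uM cu eqF.
have sincr := source_incr p a hf fv.
split.
- apply: (@far_dominatedP _ _ u v (source p a f)) => //.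
  + exact: (source_decr_near0 p2 a0 hf fsmall fincr hm hn).
  + by move=> eps eps0; exact: (source_flat_near0 a p2 hf fsmall hm hn eps0).
- exact: (@strong_maxP _ _ u v (source p a f)).
- apply: (@boundary_freeP _ _ u v (source p a f)) => //.
  by move=> yb zb y0 z0; exact: (source_lower p2 a0 hf fv y0 z0).
Qed.

End equation_to_principles.

Section swap.
Context {R : realType}.

Lemma C1_quadrant_swap (g : R -> R -> R) :
  C1_quadrant g -> C1_quadrant (fun z y => g y z).
Proof.
move=> hg z y z0 y0; have [d1 d2 c1 c2] := hg y z y0 z0.
pose sw (q : R * R) := (q.2, q.1).
have cs : {for (z, y), continuous sw} by exact: cvg_pair cvg_snd cvg_fst.
have E1 : (fun q : R * R => partial1 (fun z y => g y z) q.1 q.2) =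
    (fun q : R * R => partial2 g q.1 q.2) \o sw by [].
have E2 : (fun q : R * R => partial2 (fun z y => g y z) q.1 q.2) =
    (fun q : R * R => partial1 g q.1 q.2) \o sw by [].
split; [exact: d2 | exact: d1 | rewrite E1 | rewrite E2].
  exact: (continuous_comp cs c2).
exact: (continuous_comp cs c1).
Qed.

Lemma near_prod_swap (F G : set_system R) (P : R -> R -> Prop) :
  (\forall y \near F & z \near G, P y z) -> \forall z \near G & y \near F, P y z.
Proof.
move=> [[A B] /= [FA GB] AB]; exists (B, A) => // -[z y] [Bz Ay].
exact: (AB (y, z)).
Qed.

End swap.

Unset Implicit Arguments.

Theorem theorem1p1 (R : realType) (N : nat) (s t p a b : R)
    (Cs Ct : R) (f g : R -> R -> R) (u v : 'rV[R]_N -> R)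
    (m n q r gamma tau : R)
    (hN : (2 <= N)%N) (hs : 0 < s < 1) (ht : 0 < t < 1) (hp : 2 < p)
    (ha : 0 < a) (hb : 0 < b)
    (hCs : 0 < Cs) (hCt : 0 < Ct)
    (hf : C1_quadrant f) (hg : C1_quadrant g)
    (hu : [/\ C11_loc u, Lsp_space p s u & continuous u])
    (hv : [/\ C11_loc v, Lsp_space p t v & continuous v])
    (u_gt0 : forall x, 0 < u x) (v_gt0 : forall x, 0 < v x)
    (equ : forall x, exists2 l, is_frac_plap Cs p s u x l &
       l + a * u x `^ (p - 1) = f (u x) (v x))
    (eqv : forall x, exists2 l, is_frac_plap Ct p t v x l &
       l + b * v x `^ (p - 1) = g (u x) (v x))
    (Hi : forall y z : R, 0 < y -> 0 < z ->
       0 < partial2 f y z /\ 0 < partial1 g y z)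
    (Hii : \forall y \near 0^'+ & z \near 0^'+,
       partial1 f y z <= y `^ (m - 1) * z `^ n /\
       partial2 f y z <= y `^ m * z `^ (n - 1))
    (Hiii : \forall y \near 0^'+ & z \near 0^'+,
       partial1 g y z <= y `^ (q - 1) * z `^ r /\
       partial2 g y z <= y `^ q * z `^ (r - 1))
    (Hiv_f : exists2 e : R, 0 < e & forall z : R, 0 < z ->
       {in `]0, e[ &, {homo (fun y => partial1 f y z
          - a * (p - 1) * y `^ (p - 2)) : y1 y2 / y1 < y2}})
    (Hiv_g : exists2 e : R, 0 < e & forall y : R, 0 < y ->
       {in `]0, e[ &, {homo (fun z => partial2 g y z
          - b * (p - 1) * z `^ (p - 2)) : z1 z2 / z1 < z2}})
    (Hv_u : decays_like u gamma) (Hv_v : decays_like v tau)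
    (hm : p - 1 <= m) (hr : p - 1 <= r) (hn : 1 <= n) (hq : 1 <= q)
    (hgamma : 0 < gamma) (htau : 0 < tau)
    (hmin_f : gamma * (p - 2) + s * p <
       Num.min (gamma * (m - 1) + tau * n) (gamma * m + tau * (n - 1)))
    (hmin_g : tau * (p - 2) + t * p <
       Num.min (tau * (r - 1) + gamma * q) (tau * r + gamma * (q - 1))) :
  exists x0 : 'rV[R]_N,
    [/\ radially_symmetric_about x0 u, radially_decreasing_about x0 u,
        radially_symmetric_about x0 v & radially_decreasing_about x0 v].
Proof.
have [u11 uL cu] := hu; have [v11 vL cv] := hv.
have vu := decays_like_vanishing hgamma Hv_u.
have vv := decays_like_vanishing htau Hv_v.
have [s0 _] := andP hs; have [t0 _] := andP ht.
have [far_uv smp_uv bdy_uv] : [/\ far_dominated u v, strong_max u v & boundary_free u v].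
  apply: (@moving_plane_principles _ _ p s a Cs m n f) => //.
  by move=> y z y0 z0; have [] := Hi y z y0 z0.
have [far_vu smp_vu bdy_vu] : [/\ far_dominated v u, strong_max v u & boundary_free v u].
  apply: (@moving_plane_principles _ _ p t b Ct r q (fun z y => g y z)) => //.
  - exact: C1_quadrant_swap.
  - by move=> z y z0 y0; have [] := Hi y z y0 z0.
  - apply: near_prod_swap; move: Hiii; apply: filterS => -[y z] /= [h1 h2].
    by split; rewrite mulrC.
apply: radial_of_directions => // e e1.
exact: symmetry_direction.
Qed.
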